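(* Let $R=\mathbb F_2[z,\frac{1}{z(1+z^3)}]$ and let $G(R)=\mathfrak O^\times/R^\times$, with elements $b_1,b_2,c_1,c_2,d\in G(R)$ as defined in the context. The quaternionic arithmetic lattice $G(R)$ has the presentation $$G(R)=\left\langle b_1,b_2,c_1,c_2,d\ \left|\ \begin{array}{c}c_1^2,\ c_2^2,\ d^2,\ c_1c_2=c_2c_1,\ c_1d=dc_1,\ c_2d=dc_2,\\ b_1b_2c_1b_2,\ b_1c_2b_1b_2^{-1},\ db_1db_1,\ db_2db_2\end{array}\right.\right\rangle .$$
   Context: $K=\mathbb F_2(z)$ and $Q=K\{I,J\}/(I^2+I=z,\ J^2=1+z^3,\ IJ=J(I+1))$, a quaternion algebra over $K$ with basis $1,I,J,IJ$. $\mathfrak O=R\oplus RI\oplus RJ\oplus R\,IJ$ is an $R$-order in $Q$, and $G(R)=\mathfrak O^\times/R^\times\subseteq Q^\times/K^\times$. The elements $b_1,b_2,c_1,c_2,d\in G(R)$ are the classes of the following elements of $\mathfrak O^\times$: $B_1=(1+z)I+J$, $B_2=z+z^2+(1+z)I+J+IJ$, $C_1=1+z^2+IJ$, $C_2=z+z^2+IJ$, $D=1+z+z^2+IJ$. *)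

(* Defs.v *)
From HB Require Import structures.
From mathcomp Require Import all_boot all_order all_algebra.
From mathcomp Require Import boolp.
From mathcomp Require Import ring.

Set Implicit Arguments.
Unset Strict Implicit.
Unset Printing Implicit Defensive.

Import GRing.Theory.
Local Open Scope ring_scope.
Local Open Scope quotient_scope.

Record normal_subgroup (G : groupType) := NormalSubgroup {
  ns_pred :> {pred G};
  ns_group : group_closed ns_pred;
  ns_conj : forall x y : G, x \in ns_pred -> (x ^ y)%g \in ns_pred
}.

Section Quotient.
Variables (G : groupType) (N : normal_subgroup G).
Implicit Types x y z : G.

Lemma ns1 : 1%g \in (N : {pred G}).
Proof. exact: (ns_group N).1. Qed.

Lemma nsV x : x \in (N : {pred G}) -> (x^-1)%g \in (N : {pred G}).
Proof. exact: (group_closedV (ns_group N)). Qed.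

Lemma nsM x y : x \in (N : {pred G}) -> y \in (N : {pred G}) ->
  (x * y)%g \in (N : {pred G}).
Proof. exact: (group_closedM (ns_group N)). Qed.

Definition same_coset x y : bool := (x^-1 * y)%g \in (N : {pred G}).

Lemma same_coset_refl : reflexive same_coset.
Proof. by move=> x; rewrite /same_coset mulVg ns1. Qed.

Lemma same_coset_sym : symmetric same_coset.
Proof.
by move=> x y; apply/idP/idP=> /nsV; rewrite /same_coset invgM invgK.
Qed.

Lemma same_coset_trans : transitive same_coset.
Proof.
by move=> y x z xy yz; have := nsM xy yz; rewrite /same_coset -mulgA mulVKg.
Qed.

Canonical same_coset_equiv :=
  EquivRel same_coset same_coset_refl same_coset_sym same_coset_trans.

Definition quotient : Type := {eq_quot same_coset}.

HB.instance Definition _ : EqQuotient _ same_coset quotient :=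
  EqQuotient.on quotient.
HB.instance Definition _ := Choice.on quotient.

Definition qclass (x : G) : quotient := \pi_quotient x.

Lemma qclass_eq x y : (qclass x == qclass y) = same_coset x y.
Proof. by rewrite /qclass piE. Qed.

Lemma qclassP (X : quotient) : exists x, X = qclass x.
Proof. by exists (repr X); rewrite /qclass reprK. Qed.

Definition qmul (X Y : quotient) : quotient := qclass (repr X * repr Y)%g.
Definition qinv (X : quotient) : quotient := qclass (repr X)^-1%g.

Lemma same_coset_repr x : same_coset (repr (qclass x)) x.
Proof. by rewrite -qclass_eq /qclass reprK. Qed.

Lemma qmulE x y : qmul (qclass x) (qclass y) = qclass (x * y)%g.
Proof.
apply/eqP; rewrite qclass_eq /same_coset.
have /(ns_conj (repr (qclass y))) hx := same_coset_repr x.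
have hy := same_coset_repr y; have := nsM hx hy.
by rewrite /conjg invgM !mulgA mulgK.
Qed.

Lemma qinvE x : qinv (qclass x) = qclass x^-1%g.
Proof.
apply/eqP; rewrite qclass_eq /same_coset invgK.
have := same_coset_repr x; rewrite same_coset_sym => /(ns_conj x^-1%g).
by rewrite /conjg invgK -mulgA mulVKg.
Qed.

Lemma qmulA : associative qmul.
Proof.
move=> X Y Z; have [x ->] := qclassP X; have [y ->] := qclassP Y.
by have [z ->] := qclassP Z; rewrite !qmulE mulgA.
Qed.

Lemma qmul1 : left_id (qclass 1%g) qmul.
Proof. by move=> X; have [x ->] := qclassP X; rewrite qmulE mul1g. Qed.

Lemma qmul1r : right_id (qclass 1%g) qmul.
Proof. by move=> X; have [x ->] := qclassP X; rewrite qmulE mulg1. Qed.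

Lemma qmulV : left_inverse (qclass 1%g) qinv qmul.
Proof. by move=> X; have [x ->] := qclassP X; rewrite qinvE qmulE mulVg. Qed.

Lemma qmulVr : right_inverse (qclass 1%g) qinv qmul.
Proof. by move=> X; have [x ->] := qclassP X; rewrite qinvE qmulE mulgV. Qed.

HB.instance Definition _ :=
  isGroup.Build quotient qmulA qmul1 qmul1r qmulV qmulVr.

Lemma qclassM : {morph qclass : x y / (x * y)%g}.
Proof. by move=> x y; rewrite -qmulE. Qed.

HB.instance Definition _ := isMultiplicative.Build G quotient qclass qclassM.

End Quotient.

Section NormalClosure.
Variables (G : groupType) (A : {pred G}).

Definition in_normal_closure : {pred G} := fun x =>
  `[< forall N : normal_subgroup G,
        {subset A <= (N : {pred G})} -> x \in (N : {pred G}) >].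

Lemma normal_closure_group : group_closed in_normal_closure.
Proof.
split; first by apply/asboolP=> N _; exact: ns1.
move=> x y /asboolP hx /asboolP hy; apply/asboolP=> N AN.
by rewrite nsM ?nsV ?hx ?hy.
Qed.

Lemma normal_closure_conj x y :
  x \in in_normal_closure -> (x ^ y)%g \in in_normal_closure.
Proof. by move=> /asboolP hx; apply/asboolP=> N AN; apply/ns_conj/hx. Qed.

Definition normal_closure : normal_subgroup G :=
  NormalSubgroup normal_closure_group normal_closure_conj.

End NormalClosure.

Section FreeGroup.
Variable S : choiceType.

(* [(s, false)] is the generator s, [(s, true)] is its inverse. *)
Definition letter : Type := S * bool.
HB.instance Definition _ := Choice.on letter.

Implicit Types (a b : letter) (u v w : seq letter).

Definition linv a : letter := (a.1, ~~ a.2).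

Definition reduced w : bool := sorted (fun a b => b != linv a) w.

Definition push a w : seq letter :=
  if w is b :: w' then if b == linv a then w' else a :: w else [:: a].

Definition wmul u v : seq letter := foldr push v u.
Definition winv u : seq letter := rev (map linv u).

Lemma linvK : involutive linv.
Proof. by case=> s e; rewrite /linv /= negbK. Qed.

Lemma reduced_push a w : reduced w -> reduced (push a w).
Proof.
case: w => [|b w] //= rw; case: eqP => [_|/eqP ba]; first exact: path_sorted rw.
by rewrite /= ba.
Qed.

Lemma reduced_wmul u v : reduced v -> reduced (wmul u v).
Proof. by move=> rv; elim: u => //= a u; apply: reduced_push. Qed.

Lemma reduced_winv u : reduced u -> reduced (winv u).
Proof.
rewrite /reduced /winv rev_sorted sorted_map; apply: sub_sorted => a b /=.
by apply: contraNN => /eqP ->; rewrite linvK.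
Qed.

Lemma pushK a w : reduced w -> push (linv a) (push a w) = w.
Proof.
case: w => [|b w] /=; first by rewrite linvK eqxx.
case: eqP => [-> | _ _] /=; last by rewrite linvK eqxx.
by case: w => [|c w] //= /andP[/negPf -> _].
Qed.

Lemma wmul_push a u w : reduced w -> wmul (push a u) w = push a (wmul u w).
Proof.
case: u => [|b u] //= rw; case: eqP => [-> /=|//].
by have := pushK (linv a) (reduced_wmul u rw); rewrite linvK.
Qed.

Lemma wmulA u v w : reduced w -> wmul u (wmul v w) = wmul (wmul u v) w.
Proof. by move=> rw; elim: u => //= a u ->; rewrite wmul_push. Qed.

Lemma wmul_nil u : reduced u -> wmul u [::] = u.
Proof.
elim: u => //= a u IHu; case: u IHu => //= b u IHu /andP[ba ru].
by rewrite IHu //= (negPf ba).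
Qed.

Lemma winvK : involutive winv.
Proof.
by move=> u; rewrite /winv map_rev revK -map_comp map_id_in // => a _; apply: linvK.
Qed.

Lemma wmulV u : wmul (winv u) u = [::].
Proof.
elim: u => //= a u IHu.
by rewrite /winv /= rev_cons /wmul foldr_rcons /= linvK eqxx.
Qed.

Record free_group := FreeGroup { word_of :> seq letter; _ : reduced word_of }.

HB.instance Definition _ := [isSub for word_of].
HB.instance Definition _ := [Choice of free_group by <:].

Implicit Types x y z : free_group.

Definition fg_one : free_group := @FreeGroup [::] isT.
Definition fg_mul x y : free_group := FreeGroup (reduced_wmul x (valP y)).
Definition fg_inv x : free_group := FreeGroup (reduced_winv (valP x)).

Lemma fg_mulA : associative fg_mul.
Proof. by move=> x y z; apply/val_inj/wmulA/(valP z). Qed.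

Lemma fg_mul1 : left_id fg_one fg_mul.
Proof. by move=> x; apply/val_inj. Qed.

Lemma fg_mul1r : right_id fg_one fg_mul.
Proof. by move=> x; apply/val_inj/wmul_nil/(valP x). Qed.

Lemma fg_mulV : left_inverse fg_one fg_inv fg_mul.
Proof. by move=> x; apply/val_inj/wmulV. Qed.

Lemma fg_mulVr : right_inverse fg_one fg_inv fg_mul.
Proof. by move=> x; apply/val_inj; rewrite /= -{1}[val x]winvK wmulV. Qed.

HB.instance Definition _ :=
  isGroup.Build free_group fg_mulA fg_mul1 fg_mul1r fg_mulV fg_mulVr.

Definition fgen (s : S) : free_group := @FreeGroup [:: (s, false)] isT.

End FreeGroup.

Definition presented_group (S : choiceType) (rels : seq (free_group S)) :=
  quotient (normal_closure (mem rels)).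

HB.instance Definition _ S rels :=
  Group.on (@presented_group S rels).

Definition pgen (S : choiceType) (rels : seq (free_group S)) (s : S) :
  presented_group rels := qclass (normal_closure (mem rels)) (fgen s).

(* [G] has the presentation < S | rels >, each generator [s] standing for the
   element [g s] of [G]. *)
Definition has_presentation (G : groupType) (S : choiceType) (g : S -> G)
    (rels : seq (free_group S)) : Prop :=
  exists f : {multiplicative presented_group rels -> G},
    bijective f /\ forall s, f (pgen rels s) = g s.

Section Units.
Variable A : nzRingType.

Record units := Units {
  unit_pair : A * A;
  _ : (unit_pair.1 * unit_pair.2 == 1) && (unit_pair.2 * unit_pair.1 == 1)
}.

HB.instance Definition _ := [isSub for unit_pair].
HB.instance Definition _ := [Choice of units by <:].

Implicit Types u v w : units.

Definition uval u : A := (unit_pair u).1.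
Definition uinv u : A := (unit_pair u).2.

Lemma uvalK u : uval u * uinv u = 1.
Proof. by case/andP: (valP u) => /eqP. Qed.

Lemma uinvK u : uinv u * uval u = 1.
Proof. by case/andP: (valP u) => _ /eqP. Qed.

Lemma mkunit_proof (x y : A) : x * y = 1 -> y * x = 1 ->
  ((x, y).1 * (x, y).2 == 1) && ((x, y).2 * (x, y).1 == 1).
Proof. by move=> /= -> ->; rewrite eqxx. Qed.

Definition mkunit x y (xy : x * y = 1) (yx : y * x = 1) : units :=
  Units (mkunit_proof xy yx).

Lemma uval_inj : injective uval.
Proof.
move=> u v uv; apply/val_inj/injective_projections => //.
rewrite -[LHS]/(uinv u) -[RHS]/(uinv v) -[LHS]mulr1 -(uvalK v) -uv mulrA.
by rewrite uinvK mul1r.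
Qed.

Lemma umul_proof u v : (uval u * uval v) * (uinv v * uinv u) = 1.
Proof. by rewrite mulrA -(mulrA (uval u)) uvalK mulr1 uvalK. Qed.

Lemma umul_proof' u v : (uinv v * uinv u) * (uval u * uval v) = 1.
Proof. by rewrite mulrA -(mulrA (uinv v)) uinvK mulr1 uinvK. Qed.

Definition units_one : units := mkunit (mulr1 1) (mulr1 1).
Definition units_mul u v : units := mkunit (umul_proof u v) (umul_proof' u v).
Definition units_inv u : units := mkunit (uinvK u) (uvalK u).

Lemma units_mulA : associative units_mul.
Proof. by move=> u v w; apply/uval_inj/mulrA. Qed.

Lemma units_mul1 : left_id units_one units_mul.
Proof. by move=> u; apply/uval_inj/mul1r. Qed.

Lemma units_mul1r : right_id units_one units_mul.
Proof. by move=> u; apply/uval_inj/mulr1. Qed.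

Lemma units_mulV : left_inverse units_one units_inv units_mul.
Proof. by move=> u; apply/uval_inj/uinvK. Qed.

Lemma units_mulVr : right_inverse units_one units_inv units_mul.
Proof. by move=> u; apply/uval_inj/uvalK. Qed.

HB.instance Definition _ := isGroup.Build units
  units_mulA units_mul1 units_mul1r units_mulV units_mulVr.

Lemma uvalM u v : uval (u * v)%g = uval u * uval v.
Proof. by []. Qed.

Lemma uvalV u : uval u^-1%g = uinv u.
Proof. by []. Qed.

End Units.

(* The free F-module with basis 1, I, J, IJ and the multiplication given by
   I^2 = I + a, J^2 = b, J I = (1 - I) J.  In characteristic 2 the first and
   third relations read I^2 + I = a and I J = J (I + 1). *)

Record quat (F : comNzRingType) (a b : F) :=
  Quat { q1 : F; qI : F; qJ : F; qIJ : F }.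

Arguments Quat {F a b}.

Section Quaternion.
Variables (F : comNzRingType) (a b : F).

Local Notation quat := (quat a b).

Definition quat_to (x : quat) : (F * F) * (F * F) :=
  ((q1 x, qI x), (qJ x, qIJ x)).
Definition quat_of (p : (F * F) * (F * F)) : quat :=
  Quat p.1.1 p.1.2 p.2.1 p.2.2.
Lemma quat_toK : cancel quat_to quat_of. Proof. by case. Qed.

HB.instance Definition _ := Choice.copy quat (can_type quat_toK).

Implicit Types x y w : quat.

Definition quat_zero : quat := Quat 0 0 0 0.
Definition quat_opp x : quat := Quat (- q1 x) (- qI x) (- qJ x) (- qIJ x).
Definition quat_add x y : quat :=
  Quat (q1 x + q1 y) (qI x + qI y) (qJ x + qJ y) (qIJ x + qIJ y).
Definition quat_scale (k : F) x : quat :=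
  Quat (k * q1 x) (k * qI x) (k * qJ x) (k * qIJ x).
Definition quat_one : quat := Quat 1 0 0 0.
Definition quat_mul x y : quat :=
  let: Quat x0 x1 x2 x3 := x in
  let: Quat y0 y1 y2 y3 := y in
  Quat (x0 * y0 + a * x1 * y1 + b * (x2 * (y2 + y3) - a * x3 * y3))
       (x0 * y1 + x1 * y0 + x1 * y1 + b * (x3 * y2 - x2 * y3))
       (x0 * y2 + a * x1 * y3 + x2 * (y0 + y1) - a * x3 * y1)
       (x0 * y3 + x1 * y2 + x1 * y3 + x3 * y0 - x2 * y1).

Lemma quat_addA : associative quat_add.
Proof. by case=> ? ? ? ? [? ? ? ?] [? ? ? ?]; congr Quat; apply: addrA. Qed.
Lemma quat_addC : commutative quat_add.
Proof. by case=> ? ? ? ? [? ? ? ?]; congr Quat; apply: addrC. Qed.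
Lemma quat_add0 : left_id quat_zero quat_add.
Proof. by case=> ? ? ? ?; congr Quat; apply: add0r. Qed.
Lemma quat_addN : left_inverse quat_zero quat_opp quat_add.
Proof. by case=> ? ? ? ?; congr Quat; apply: addNr. Qed.

HB.instance Definition _ :=
  GRing.isZmodule.Build quat quat_addA quat_addC quat_add0 quat_addN.

Lemma quat_mulA : associative quat_mul.
Proof. by case=> ? ? ? ? [? ? ? ?] [? ? ? ?]; congr Quat => /=; ring. Qed.
Lemma quat_mul1 : left_id quat_one quat_mul.
Proof. by case=> ? ? ? ?; congr Quat => /=; ring. Qed.
Lemma quat_mul1r : right_id quat_one quat_mul.
Proof. by case=> ? ? ? ?; congr Quat => /=; ring. Qed.
Lemma quat_mulDl : left_distributive quat_mul +%R.
Proof. by case=> ? ? ? ? [? ? ? ?] [? ? ? ?]; congr Quat => /=; ring. Qed.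
Lemma quat_mulDr : right_distributive quat_mul +%R.
Proof. by case=> ? ? ? ? [? ? ? ?] [? ? ? ?]; congr Quat => /=; ring. Qed.
Lemma quat_one_neq0 : quat_one != 0.
Proof. by apply/eqP=> -[] /eqP; rewrite oner_eq0. Qed.

HB.instance Definition _ := GRing.Zmodule_isNzRing.Build quat
  quat_mulA quat_mul1 quat_mul1r quat_mulDl quat_mulDr quat_one_neq0.

Lemma quat_scaleA k l x : quat_scale k (quat_scale l x) = quat_scale (k * l) x.
Proof. by congr Quat; apply: mulrA. Qed.
Lemma quat_scale1 : left_id 1 quat_scale.
Proof. by case=> ? ? ? ?; congr Quat; apply: mul1r. Qed.
Lemma quat_scaleDr : right_distributive quat_scale +%R.
Proof. by move=> k x y; congr Quat; apply: mulrDr. Qed.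
Lemma quat_scaleDl x : {morph quat_scale^~ x : k l / k + l}.
Proof. by move=> k l; congr Quat; apply: mulrDl. Qed.

HB.instance Definition _ := GRing.Zmodule_isLmodule.Build F quat
  quat_scaleA quat_scale1 quat_scaleDr quat_scaleDl.

Lemma quat_scaleAl k x y : k *: (x * y) = k *: x * y.
Proof. by case: x y => ? ? ? ? [? ? ? ?]; congr Quat => /=; ring. Qed.

HB.instance Definition _ := GRing.Lmodule_isLalgebra.Build F quat quat_scaleAl.

Lemma quat_scaleAr k x y : k *: (x * y) = x * (k *: y).
Proof. by case: x y => ? ? ? ? [? ? ? ?]; congr Quat => /=; ring. Qed.

HB.instance Definition _ := GRing.Lalgebra_isAlgebra.Build F quat quat_scaleAr.

Definition quatI : quat := Quat 0 1 0 0.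
Definition quatJ : quat := Quat 0 0 1 0.

Lemma quat_basis x :
  x = q1 x *: 1 + qI x *: quatI + qJ x *: quatJ + qIJ x *: (quatI * quatJ).
Proof. by case: x => ? ? ? ?; congr Quat => /=; ring. Qed.

Lemma quatI2 : quatI ^+ 2 = quatI + a%:A.
Proof. by congr Quat => /=; ring. Qed.
Lemma quatJ2 : quatJ ^+ 2 = b%:A.
Proof. by congr Quat => /=; ring. Qed.
Lemma quatJI : quatJ * quatI = (1 - quatI) * quatJ.
Proof. by congr Quat => /=; ring. Qed.

Lemma quatI2_char2 : 1 + 1 = 0 :> F -> quatI ^+ 2 + quatI = a%:A.
Proof.
move=> two0; rewrite quatI2 addrAC -[quatI]scale1r -scalerDl two0 scale0r.
by rewrite add0r.
Qed.

Lemma quatIJ_char2 : 1 + 1 = 0 :> F -> quatI * quatJ = quatJ * (quatI + 1).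
Proof.
move=> two0; have add2 (k l : F) : k = l + (1 + 1) -> k = l.
  by rewrite two0 addr0.
congr Quat => /=; first [ring | by apply: add2; ring | by apply/esym/add2; ring].
Qed.

Definition quat_conj x : quat := Quat (q1 x + qI x) (- qI x) (- qJ x) (- qIJ x).
Definition quat_norm x : F :=
  q1 x ^+ 2 + q1 x * qI x - a * qI x ^+ 2
  - b * (qJ x ^+ 2 + qJ x * qIJ x - a * qIJ x ^+ 2).

Lemma quat_mul_conj x : x * quat_conj x = (quat_norm x)%:A.
Proof. by case: x => ? ? ? ?; congr Quat; rewrite /quat_norm /=; ring. Qed.
Lemma quat_conj_mul x : quat_conj x * x = (quat_norm x)%:A.
Proof. by case: x => ? ? ? ?; congr Quat; rewrite /quat_norm /=; ring. Qed.

End Quaternion.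

Definition K : fieldType := {fraction {poly 'F_2}}.

Definition z : K := tofrac 'X.

Definition Q : algType K := quat z (1 + z ^+ 3).

Definition QI : Q := quatI z (1 + z ^+ 3).
Definition QJ : Q := quatJ z (1 + z ^+ 3).

Lemma K_two : 1 + 1 = 0 :> K.
Proof.
have two0 : 1 + 1 = 0 :> {poly 'F_2} by rewrite -polyCD; apply/eqP; rewrite polyC_eq0.
by rewrite -[RHS](@tofrac0 {poly 'F_2}) -two0 tofracD tofrac1.
Qed.

Lemma K_opp (x : K) : - x = x.
Proof.
by apply/esym/eqP; rewrite -addr_eq0 -[x]mul1r -mulrDl K_two mul0r.
Qed.

Lemma QI_rel : QI ^+ 2 + QI = z%:A.
Proof. exact: quatI2_char2 K_two. Qed.

Lemma QJ_rel : QJ ^+ 2 = (1 + z ^+ 3)%:A.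
Proof. exact: quatJ2. Qed.

Lemma QIQJ_rel : QI * QJ = QJ * (QI + 1).
Proof. exact: quatIJ_char2 K_two. Qed.

(* R is the image of F_2[z][t] under t |-> 1 / (z (1 + z^3)). *)
Definition inR : {pred K} := fun x =>
  `[< exists P : {poly {poly 'F_2}},
        x = (map_poly (@tofrac _) P).[(z * (1 + z ^+ 3))^-1] >].

Lemma inR_subring : subring_closed inR.
Proof.
split.
- by apply/asboolP; exists 1; rewrite rmorph1 hornerC.
- move=> x y /asboolP[P ->] /asboolP[P' ->]; apply/asboolP; exists (P - P').
  by rewrite rmorphB hornerD hornerN.
- move=> x y /asboolP[P ->] /asboolP[P' ->]; apply/asboolP; exists (P * P').
  by rewrite rmorphM hornerM.
Qed.

HB.instance Definition _ := GRing.isSubringClosed.Build K inR inR_subring.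

Lemma inR_z : z \in inR.
Proof. by apply/asboolP; exists (polyC 'X); rewrite map_polyC hornerC. Qed.

Lemma inR_inv : (z * (1 + z ^+ 3))^-1 \in inR.
Proof. by apply/asboolP; exists 'X; rewrite map_polyX hornerX. Qed.

Record R := MkR { valR : K; _ : valR \in inR }.
HB.instance Definition _ := [isSub for valR].
HB.instance Definition _ := [Choice of R by <:].
HB.instance Definition _ := [SubChoice_isSubComNzRing of R by <:].

Definition in_frakO : {pred Q} := fun x =>
  [&& q1 x \in inR, qI x \in inR, qJ x \in inR & qIJ x \in inR].

Lemma frakO_subring : subring_closed in_frakO.
Proof.
split.
- by apply/and4P; split; rewrite ?rpred0 ?rpred1.
- move=> x y /and4P[? ? ? ?] /and4P[? ? ? ?]; apply/and4P.
  by split; apply: rpredB.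
- case=> [x0 x1 x2 x3] [y0 y1 y2 y3] /and4P/=[? ? ? ?] /and4P/=[? ? ? ?].
  by apply/and4P; split; rewrite /= ?(rpredB, rpredD, rpredM, inR_z, rpredX, rpred1).
Qed.

HB.instance Definition _ := GRing.isSubringClosed.Build Q in_frakO frakO_subring.

(* By quat_basis, frakO is the R-submodule of Q with basis 1, QI, QJ, IJ. *)
Record frakO := MkFrakO { val_frakO : Q; _ : val_frakO \in in_frakO }.
HB.instance Definition _ := [isSub for val_frakO].
HB.instance Definition _ := [Choice of frakO by <:].
HB.instance Definition _ := [SubChoice_isSubNzRing of frakO by <:].

Definition is_scalar : {pred units frakO} := fun u =>
  `[< exists r : units R, val_frakO (uval u) = (valR (uval r))%:A >].

Lemma is_scalar_group : group_closed is_scalar.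
Proof.
split.
- by apply/asboolP; exists 1%g; rewrite [RHS]scale1r.
- move=> u v /asboolP[r hr] /asboolP[s hs]; apply/asboolP; exists (r / s)%g.
  have hV : val_frakO (uinv v) = (valR (uinv s))%:A.
    have vK : val_frakO (uval v) * val_frakO (uinv v) = 1.
      by rewrite -[LHS]/(val_frakO (uval v * uinv v)) uvalK.
    have sK : valR (uinv s) * valR (uval s) = 1.
      by rewrite -[LHS]/(valR (uinv s * uval s)) uinvK.
    by rewrite -[LHS]scale1r -sK -scalerA -[X in _ *: X]mulr_algl -hs vK.
  rewrite -[LHS]/(val_frakO (uval u) * val_frakO (uinv v)) hr hV mulr_algl scalerA.
  by [].
Qed.

Lemma is_scalar_conj u v : u \in is_scalar -> (u ^ v)%g \in is_scalar.
Proof.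
move=> /asboolP[r hr]; apply/asboolP; exists r; rewrite -hr; congr val_frakO.
rewrite -[LHS]/(uinv v * (uval u * uval v)).
have -> : uval u * uval v = uval v * uval u.
  by apply: val_inj; rewrite !rmorphM /= hr mulr_algl mulr_algr.
by rewrite mulrA uinvK mul1r.
Qed.

(* The image of R^x in frakO^x. *)
Definition scalar_units : normal_subgroup (units frakO) :=
  NormalSubgroup is_scalar_group is_scalar_conj.

Definition GR := quotient scalar_units.
HB.instance Definition _ := Group.on GR.

Section UnitOfNorm.
Variables (x : Q) (k : K).
Hypotheses (xO : x \in in_frakO) (kR : k \in inR) (kx : k * quat_norm x = 1).

Lemma inv_in_frakO : k *: quat_conj x \in in_frakO.
Proof.
case/and4P: xO => ? ? ? ?.
by apply/and4P; split=> /=; rewrite rpredM ?rpredN ?rpredD.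
Qed.

Lemma mul_inv : MkFrakO xO * MkFrakO inv_in_frakO = 1.
Proof.
apply: val_inj; rewrite rmorphM rmorph1 /= -scalerAr quat_mul_conj scalerA kx.
exact: scale1r.
Qed.

Lemma inv_mul : MkFrakO inv_in_frakO * MkFrakO xO = 1.
Proof.
apply: val_inj; rewrite rmorphM rmorph1 /= -scalerAl quat_conj_mul scalerA kx.
exact: scale1r.
Qed.

Definition unit_of_norm : units frakO := mkunit mul_inv inv_mul.

Lemma unit_of_normE : val_frakO (uval unit_of_norm) = x.
Proof. by []. Qed.

End UnitOfNorm.

Definition B1 : Q := (1 + z) *: QI + QJ.
Definition B2 : Q := (z + z ^+ 2)%:A + (1 + z) *: QI + QJ + QI * QJ.
Definition C1 : Q := (1 + z ^+ 2)%:A + QI * QJ.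
Definition C2 : Q := (z + z ^+ 2)%:A + QI * QJ.
Definition D : Q := (1 + z + z ^+ 2)%:A + QI * QJ.

Lemma frakO_basis (k0 k1 k2 k3 : K) :
  k0 \in inR -> k1 \in inR -> k2 \in inR -> k3 \in inR ->
  k0%:A + k1 *: QI + k2 *: QJ + k3 *: (QI * QJ) \in in_frakO.
Proof.
move=> *; have -> : k0%:A + k1 *: QI + k2 *: QJ + k3 *: (QI * QJ) =
    Quat k0 k1 k2 k3 :> Q by rewrite [RHS]quat_basis.
exact/and4P.
Qed.

Lemma z_unit : z * (1 + z ^+ 3) != 0.
Proof.
have -> : z * (1 + z ^+ 3) = tofrac ('X * (1 + 'X^3)).
  by rewrite tofracM tofracD tofrac1 tofracXn.
rewrite tofrac_eq0 mulf_neq0 ?polyX_eq0 //.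
by apply/eqP=> /(congr1 (horner^~ 0)) /eqP; rewrite !hornerE.
Qed.

Lemma K_add2 (k l m : K) : k = l + (1 + 1) * m -> k = l.
Proof. by rewrite K_two mul0r addr0. Qed.

Lemma inv_part (k l m : K) :
  k * l = z * (1 + z ^+ 3) + (1 + 1) * m ->
  k * (z * (1 + z ^+ 3))^-1 * l = 1.
Proof. by move=> /K_add2 kl; rewrite mulrAC kl mulfV ?z_unit. Qed.

Lemma inv_1z : z * (1 + z + z ^+ 2) * (z * (1 + z ^+ 3))^-1 * (1 + z) = 1.
Proof. by apply: (@inv_part _ _ (z ^+ 2 + z ^+ 3)); ring. Qed.

Lemma inv_zz2 : (1 + z + z ^+ 2) * (z * (1 + z ^+ 3))^-1 * (z + z ^+ 2) = 1.
Proof. by apply: (@inv_part _ _ (z ^+ 2 + z ^+ 3)); ring. Qed.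

Lemma inv_1zz2 : z * (1 + z) * (z * (1 + z ^+ 3))^-1 * (1 + z + z ^+ 2) = 1.
Proof. by apply: (@inv_part _ _ (z ^+ 2 + z ^+ 3)); ring. Qed.

Lemma B1E : B1 = Quat 0 (1 + z) 1 0.
Proof. by congr Quat => /=; ring. Qed.
Lemma B2E : B2 = Quat (z + z ^+ 2) (1 + z) 1 1.
Proof. by congr Quat => /=; ring. Qed.
Lemma C1E : C1 = Quat (1 + z ^+ 2) 0 0 1.
Proof. by congr Quat => /=; ring. Qed.
Lemma C2E : C2 = Quat (z + z ^+ 2) 0 0 1.
Proof. by congr Quat => /=; ring. Qed.
Lemma DE : D = Quat (1 + z + z ^+ 2) 0 0 1.
Proof. by congr Quat => /=; ring. Qed.

Lemma inR_zX n : z ^+ n \in inR.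
Proof. by rewrite rpredX ?inR_z. Qed.

Definition in_inR := (inR_zX, inR_z, inR_inv, rpredD, rpredM, rpred1, rpred0).

Lemma B1_in_frakO : B1 \in in_frakO.
Proof. by rewrite B1E; apply/and4P; split; rewrite /= ?in_inR. Qed.
Lemma B2_in_frakO : B2 \in in_frakO.
Proof. by rewrite B2E; apply/and4P; split; rewrite /= ?in_inR. Qed.
Lemma C1_in_frakO : C1 \in in_frakO.
Proof. by rewrite C1E; apply/and4P; split; rewrite /= ?in_inR. Qed.
Lemma C2_in_frakO : C2 \in in_frakO.
Proof. by rewrite C2E; apply/and4P; split; rewrite /= ?in_inR. Qed.
Lemma D_in_frakO : D \in in_frakO.
Proof. by rewrite DE; apply/and4P; split; rewrite /= ?in_inR. Qed.

Lemma B1_norm : quat_norm B1 = 1 + z.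
Proof.
rewrite B1E /quat_norm /=.
by apply: (@K_add2 _ _ (- (1 + z + z ^+ 2 + z ^+ 3))); ring.
Qed.
Lemma B2_norm : quat_norm B2 = z + z ^+ 2.
Proof.
by rewrite B2E /quat_norm /=; apply: (@K_add2 _ _ (z ^+ 4 - 1)); ring.
Qed.
Lemma C1_norm : quat_norm C1 = 1 + z.
Proof.
by rewrite C1E /quat_norm /=; apply: (@K_add2 _ _ (z ^+ 2 + z ^+ 4)); ring.
Qed.
Lemma C2_norm : quat_norm C2 = z + z ^+ 2.
Proof.
by rewrite C2E /quat_norm /=; apply: (@K_add2 _ _ (z ^+ 3 + z ^+ 4)); ring.
Qed.
Lemma D_norm : quat_norm D = 1 + z + z ^+ 2.
Proof.
rewrite DE /quat_norm /=.
by apply: (@K_add2 _ _ (z + z ^+ 2 + z ^+ 3 + z ^+ 4)); ring.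
Qed.

Lemma inv_1z_inR : z * (1 + z + z ^+ 2) * (z * (1 + z ^+ 3))^-1 \in inR.
Proof. by rewrite ?in_inR. Qed.
Lemma inv_zz2_inR : (1 + z + z ^+ 2) * (z * (1 + z ^+ 3))^-1 \in inR.
Proof. by rewrite ?in_inR. Qed.
Lemma inv_1zz2_inR : z * (1 + z) * (z * (1 + z ^+ 3))^-1 \in inR.
Proof. by rewrite ?in_inR. Qed.

Definition B1u : units frakO := unit_of_norm B1_in_frakO inv_1z_inR
  (etrans (congr1 _ B1_norm) inv_1z).
Definition B2u : units frakO := unit_of_norm B2_in_frakO inv_zz2_inR
  (etrans (congr1 _ B2_norm) inv_zz2).
Definition C1u : units frakO := unit_of_norm C1_in_frakO inv_1z_inR
  (etrans (congr1 _ C1_norm) inv_1z).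
Definition C2u : units frakO := unit_of_norm C2_in_frakO inv_zz2_inR
  (etrans (congr1 _ C2_norm) inv_zz2).
Definition Du : units frakO := unit_of_norm D_in_frakO inv_1zz2_inR
  (etrans (congr1 _ D_norm) inv_1zz2).

Lemma generatorsE :
  [/\ val_frakO (uval B1u) = B1, val_frakO (uval B2u) = B2, val_frakO (uval C1u) = C1,
      val_frakO (uval C2u) = C2 & val_frakO (uval Du) = D].
Proof. by []. Qed.

Inductive gen := gb1 | gb2 | gc1 | gc2 | gd.

Definition gen_to (g : gen) : nat :=
  match g with gb1 => 0 | gb2 => 1 | gc1 => 2 | gc2 => 3 | gd => 4 end.
Definition gen_of (n : nat) : gen :=
  match n with 0 => gb1 | 1 => gb2 | 2 => gc1 | 3 => gc2 | _ => gd end.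
Lemma gen_toK : cancel gen_to gen_of. Proof. by case. Qed.

HB.instance Definition _ := Countable.copy gen (can_type gen_toK).

Definition GR_gen (g : gen) : GR :=
  qclass scalar_units
    match g with
    | gb1 => B1u | gb2 => B2u | gc1 => C1u | gc2 => C2u | gd => Du
    end.

(* A relation u = v is encoded by the relator u / v. *)
Definition GR_rels : seq (free_group gen) :=
  let b1 := fgen gb1 in let b2 := fgen gb2 in
  let c1 := fgen gc1 in let c2 := fgen gc2 in let d := fgen gd in
  [:: c1 ^+ 2; c2 ^+ 2; d ^+ 2;
      (c1 * c2) / (c2 * c1); (c1 * d) / (d * c1); (c2 * d) / (d * c2);
      b1 * b2 * c1 * b2; b1 * c2 * b1 * b2^-1;
      d * b1 * d * b1; d * b2 * d * b2]%g.

(* Main.v *)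
Require Import Defs.
From HB Require Import structures.
From mathcomp Require Import all_boot all_order all_algebra.
From mathcomp Require Import boolp zify.
From Stdlib Require Import Ring.

(* [G(R)] acts on the product of the 3-regular trees of [Q] at the places z = 0
   and z = infinity; <b1, b2, c1, c2> is simply transitive on the vertices and
   [d] generates the stabiliser of the base vertex.  The polynomial order [A]
   reduces to M_2(F_2) at z = 0, and there b2, b2^-1, c2 become three matrices of
   rank one, while b1, b1^-1, c1, d become invertible.  A semilinear
   substitution z |-> 1/z of [Q] exchanges the two places and (up to scalars and
   inverses) the letters b1, c1 with b2, c2, so the place at infinity needs no
   separate treatment.
   Injectivity: the relations bring each element of the presented group to the
   form h v d^n with h, v reduced words in b1, c1 and in b2, c2.  Ping-pong on
   M_2(F_2) shows that a nonempty reduced word reduces to a nonzero singular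
   matrix, hence is not scalar.
   Surjectivity: if z divides the norm of a primitive element, its reduction is
   singular and one of the three letters lowers the valuation of the norm; after
   doing so at both places, degrees and ramification at 1 + z and 1 + z + z^2
   leave only the classes of 1 and d. *)

Set Implicit Arguments.
Unset Strict Implicit.
Unset Printing Implicit Defensive.

Import GRing.Theory.
Local Open Scope ring_scope.

(** * Identities in characteristic 2 *)

Section Char2.
Variables (F : comNzRingType) (two0 : 1 + 1 = 0 :> F).

Lemma char2_opp (x : F) : - x = x.
Proof. by apply/esym/eqP; rewrite -addr_eq0 -[x]mul1r -mulrDl two0 mul0r. Qed.

(* [ring] compares operations syntactically, whereas MathComp inserts varying
   instance paths; rewriting with these aliases makes the paths agree. *)
Definition radd (x y : F) : F := x + y.
Definition rmul (x y : F) : F := x * y.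
Definition ropp (x : F) : F := - x.
Definition rzero : F := 0.
Definition rone : F := 1.
Definition F2_cst (b : bool) : F := if b then rone else rzero.

Lemma char2_ring :
  ring_theory rzero rone radd rmul (fun x y => radd x (ropp y)) ropp eq.
Proof.
split=> //; [exact: add0r|exact: addrC|exact: addrA|exact: mul1r|
  exact: mulrC|exact: mulrA|exact: mulrDl|exact: subrr].
Qed.

(** Coefficients are taken in [bool] with [xorb] and [andb], so that [ring] computes modulo 2 and
    treats -x as x. *)
Lemma char2_morph :
  ring_morph rzero rone radd rmul (fun x y => radd x (ropp y)) ropp eq
    false true xorb andb xorb id Bool.eqb F2_cst.
Proof.
split=> //; rewrite /F2_cst /radd /rmul /ropp /rzero /rone.
- by case; case=> /=; rewrite ?add0r ?addr0 ?two0.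
- by case; case=> /=; rewrite ?subr0 ?sub0r ?subrr ?char2_opp.
- by case; case=> /=; rewrite ?mul0r ?mulr0 ?mul1r.
- by case; rewrite /= ?oppr0 ?char2_opp.
- by case; case.
Qed.

Add Ring char2 : char2_ring (morphism char2_morph).

Lemma raddE (x y : F) : x + y = radd x y. Proof. by []. Qed.
Lemma rmulE (x y : F) : x * y = rmul x y. Proof. by []. Qed.
Lemma roppE (x : F) : - x = ropp x. Proof. by []. Qed.
Lemma rzeroE : 0 = rzero. Proof. by []. Qed.
Lemma roneE : 1 = rone. Proof. by []. Qed.

Ltac reify2 := rewrite ?(exprS, expr0, raddE, rmulE, roppE, rzeroE, roneE) /=;
  apply: (@id (@eq F _ _)).
Ltac ring2 := reify2; ring.

Section Norm.
Variables a b : F.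
Implicit Types x y : quat a b.

Lemma quat_normM x y : quat_norm (x * y) = quat_norm x * quat_norm y.
Proof. by case: x y => ? ? ? ? [? ? ? ?]; rewrite /quat_norm /=; ring2. Qed.

Lemma quat_norm_conj x : quat_norm (quat_conj x) = quat_norm x.
Proof. by case: x => ? ? ? ?; rewrite /quat_norm /=; ring2. Qed.

Lemma quat_normZ k x : quat_norm (k *: x) = k ^+ 2 * quat_norm x.
Proof. by case: x => ? ? ? ?; rewrite /quat_norm /=; ring2. Qed.

Lemma quat_norm_scalar k : quat_norm (k%:A : quat a b) = k ^+ 2.
Proof. by rewrite /quat_norm /=; ring2. Qed.

End Norm.

(** * The generators and their relations over a ring of characteristic 2 *)

Local Notation qt c := (quat c (1 + c ^+ 3)).

(** The parameter c replaces z, because these elements are needed over K for both z and 1/z, over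
    F_2[z], and over F_2 with c = 0. *)
Definition bq1 (c : F) : qt c := Quat 0 (1 + c) 1 0.
Definition bq2 (c : F) : qt c := Quat (c + c ^+ 2) (1 + c) 1 1.
Definition cq1 (c : F) : qt c := Quat (1 + c ^+ 2) 0 0 1.
Definition cq2 (c : F) : qt c := Quat (c + c ^+ 2) 0 0 1.
Definition dq (c : F) : qt c := Quat (1 + c + c ^+ 2) 0 0 1.

Lemma norm_bq1 c : quat_norm (bq1 c) = 1 + c.
Proof. by rewrite /quat_norm /=; ring2. Qed.
Lemma norm_bq2 c : quat_norm (bq2 c) = c * (1 + c).
Proof. by rewrite /quat_norm /=; ring2. Qed.
Lemma norm_cq2 c : quat_norm (cq2 c) = c * (1 + c).
Proof. by rewrite /quat_norm /=; ring2. Qed.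
Lemma norm_dq c : quat_norm (dq c) = 1 + c + c ^+ 2.
Proof. by rewrite /quat_norm /=; ring2. Qed.

Lemma rel_c1c1 c : cq1 c * cq1 c = (1 + c)%:A.
Proof. by congr Quat => /=; ring2. Qed.
Lemma rel_c2c2 c : cq2 c * cq2 c = (c * (1 + c))%:A.
Proof. by congr Quat => /=; ring2. Qed.
Lemma rel_dd c : dq c * dq c = (1 + c + c ^+ 2)%:A.
Proof. by congr Quat => /=; ring2. Qed.
Lemma rel_c1c2 c : cq1 c * cq2 c = cq2 c * cq1 c.
Proof. by congr Quat => /=; ring2. Qed.
Lemma rel_c1d c : cq1 c * dq c = dq c * cq1 c.
Proof. by congr Quat => /=; ring2. Qed.
Lemma rel_c2d c : cq2 c * dq c = dq c * cq2 c.
Proof. by congr Quat => /=; ring2. Qed.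
Lemma rel_bbcb c : bq1 c * bq2 c * cq1 c * bq2 c = (c * (1 + c) ^+ 2)%:A.
Proof. by congr Quat => /=; ring2. Qed.
Lemma rel_bcb c : bq1 c * cq2 c * bq1 c = (1 + c) *: bq2 c.
Proof. by congr Quat => /=; ring2. Qed.
Lemma rel_db1 c : dq c * bq1 c * dq c * bq1 c = ((1 + c) * (1 + c + c ^+ 2))%:A.
Proof. by congr Quat => /=; ring2. Qed.
Lemma rel_db2 c :
  dq c * bq2 c * dq c * bq2 c = (c * (1 + c) * (1 + c + c ^+ 2))%:A.
Proof. by congr Quat => /=; ring2. Qed.

(* The norm form of the subalgebra generated by I. *)
Definition nf (c x y : F) : F := x ^+ 2 + x * y + c * y ^+ 2.

(** In characteristic 2, 1 + c^3 = (1 + c)(1 + c + c^2). Modulo either factor only the norm form of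
    the first two coordinates survives. *)
Lemma quat_norm_nf c (x : qt c) : quat_norm x =
  nf c (q1 x) (qI x) + (1 + c) * (1 + c + c ^+ 2) * nf c (qJ x) (qIJ x).
Proof. by case: x => ? ? ? ?; rewrite /quat_norm /nf /=; ring2. Qed.

Lemma nfZ c k x y : nf c (k * x) (k * y) = k ^+ 2 * nf c x y.
Proof. by rewrite /nf; ring2. Qed.

(** Division with remainder by r, using c^2 = r + 1 + c. The summand without the factor r is linear
    in c when k, l, m, n are constants. *)
Lemma nf_reduce c (r := 1 + c + c ^+ 2) (u v k l m n : F) :
  nf c (u * r + (k + l * c)) (v * r + (m + n * c)) =
  (u ^+ 2 * r + u * v * r + u * (m + n * c) + v * (k + l * c)
   + c * v ^+ 2 * r + l ^+ 2 + l * n + n ^+ 2 * (1 + c)) * r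
  + (k ^+ 2 + l ^+ 2 + k * m + l * n + n ^+ 2
     + (l ^+ 2 + k * n + l * m + l * n + m ^+ 2) * c).
Proof. by rewrite /nf /r; ring2. Qed.

(** Modulo r, [dq c] is IJ, and IJ times xJ + yIJ carries the factor J^2 = 1 + c^3, a multiple of
    r. *)
Lemma dq_divides c (r := 1 + c + c ^+ 2) (u v x y : F) :
  quat_conj (dq c) * (Quat (r * u) (r * v) x y : qt c) =
  r *: Quat (r * u + (1 + c) * c * y) (r * v + (1 + c) * x) (x + c * v) (y + u).
Proof. by rewrite /r; congr Quat => /=; ring2. Qed.

Lemma places_factors (c : F) :
  c * (1 + c) * (1 + c + c ^+ 2) = c * (1 + c ^+ 3).
Proof. by ring2. Qed.

(** * The substitution z -> 1/z *)

Section Inversion.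
Variables (c w : F) (cw : c * w = 1).

Lemma places_inversion :
  w * (1 + w) * (1 + w + w ^+ 2) = w ^+ 5 * (c * (1 + c ^+ 3)).
Proof. have cwr : @eq F (rmul c w) rone := cw; reify2; ring [cwr]. Qed.

(* With w = 1/c, the elements I' = c + I + (J + IJ)/c and J' = (J + IJ)/c^2
   satisfy the relations of I, J for w in place of c; [qinvert] maps I, J to
   I', J'. *)
Definition qinvert (x : qt w) : qt c :=
  Quat (q1 x + c * qI x + w ^+ 2 * (1 + c ^+ 3) * qIJ x)
       (qI x)
       (w * qI x + w ^+ 2 * qJ x)
       (w * qI x + w ^+ 2 * qJ x + w * qIJ x).

Definition qrevert (y : qt c) : qt w :=
  Quat (q1 y + c * qI y + w * (1 + c ^+ 3) * (qJ y + qIJ y))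
       (qI y)
       (c * qI y + c ^+ 2 * qJ y)
       (c * (qJ y + qIJ y)).

Let cwr : @eq F (rmul c w) rone := cw.
Ltac ring2i := reify2; ring [cwr].

Lemma qinvertK : cancel qinvert qrevert.
Proof. by case=> ? ? ? ?; congr Quat => /=; ring2i. Qed.

Lemma qrevertK : cancel qrevert qinvert.
Proof. by case=> ? ? ? ?; congr Quat => /=; ring2i. Qed.

Lemma qinvertM x y : qinvert (x * y) = qinvert x * qinvert y.
Proof. by case: x y => ? ? ? ? [? ? ? ?]; congr Quat => /=; ring2i. Qed.

Lemma qinvert1 : qinvert 1 = 1.
Proof. by congr Quat => /=; ring2i. Qed.

Lemma qinvertZ k x : qinvert (k *: x) = k *: qinvert x.
Proof. by case: x => ? ? ? ?; congr Quat => /=; ring2i. Qed.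

Lemma qinvert_norm x : quat_norm (qinvert x) = quat_norm x.
Proof. by case: x => ? ? ? ?; rewrite /quat_norm /=; ring2i. Qed.

Lemma qinvert_conj x : qinvert (quat_conj x) = quat_conj (qinvert x).
Proof. by case: x => ? ? ? ?; congr Quat => /=; ring2i. Qed.

Lemma qinvert_bq1 : qinvert (bq1 w) = w *: bq2 c.
Proof. by congr Quat => /=; ring2i. Qed.
Lemma qinvert_bq2 : qinvert (bq2 w) = w *: quat_conj (bq1 c).
Proof. by congr Quat => /=; ring2i. Qed.
Lemma qinvert_cq1 : qinvert (cq1 w) = w *: cq2 c.
Proof. by congr Quat => /=; ring2i. Qed.
Lemma qinvert_cq2 : qinvert (cq2 w) = w *: cq1 c.
Proof. by congr Quat => /=; ring2i. Qed.
Lemma qinvert_dq : qinvert (dq w) = w *: dq c.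
Proof. by congr Quat => /=; ring2i. Qed.

End Inversion.
End Char2.

(** * Letters and their reduction to M_2(F_2) *)

Local Notation qt c := (quat c (1 + c ^+ 3)).

Inductive letter3 := Lp | Lm | Lc.

Definition inv3 (l : letter3) : letter3 :=
  match l with Lp => Lm | Lm => Lp | Lc => Lc end.

Lemma inv3K : involutive inv3. Proof. by case. Qed.

(* Letters up to scalars, so that conjugates stand for inverses: [vq] moves the
   base vertex of the tree at c = 0 and [hq] fixes it. *)
Definition vq (F : comNzRingType) (c : F) (l : letter3) : qt c :=
  match l with Lp => bq2 c | Lm => quat_conj (bq2 c) | Lc => cq2 c end.

Definition hq (F : comNzRingType) (c : F) (l : letter3) : qt c :=
  match l with Lp => quat_conj (bq1 c) | Lm => bq1 c | Lc => cq1 c end.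

Section BaseChange.
Variables (F F' : comNzRingType) (e : {rmorphism F -> F'}) (c : F) (c' : F').
Hypothesis ec : e c = c'.

Definition qmap (x : qt c) : qt c' :=
  Quat (e (q1 x)) (e (qI x)) (e (qJ x)) (e (qIJ x)).

Let morphE := (rmorphD e, rmorphB e, rmorphN e, rmorphM e, rmorphXn e,
  rmorph1 e, rmorph0 e, ec).

Lemma qmapM x y : qmap (x * y) = qmap x * qmap y.
Proof. by case: x y => ? ? ? ? [? ? ? ?]; congr Quat; rewrite /= !morphE. Qed.

Lemma qmap1 : qmap 1 = 1.
Proof. by congr Quat; rewrite /= !morphE. Qed.

Lemma qmapZ k x : qmap (k *: x) = e k *: qmap x.
Proof. by case: x => ? ? ? ?; congr Quat; rewrite /= !morphE. Qed.

Lemma qmap_norm x : quat_norm (qmap x) = e (quat_norm x).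
Proof. by case: x => ? ? ? ?; rewrite /quat_norm /= !morphE. Qed.

Lemma qmap_conj x : qmap (quat_conj x) = quat_conj (qmap x).
Proof. by case: x => ? ? ? ?; congr Quat; rewrite /= ?morphE. Qed.

Lemma qmap_vq l : qmap (vq c l) = vq c' l.
Proof. by case: l; congr Quat; rewrite /= ?morphE. Qed.

Lemma qmap_hq l : qmap (hq c l) = hq c' l.
Proof. by case: l; congr Quat; rewrite /= ?morphE. Qed.

Lemma qmap_dq : qmap (dq c) = dq c'.
Proof. by congr Quat; rewrite /= ?morphE. Qed.

End BaseChange.

Lemma F2P (x : 'F_2) : x = 0 \/ x = 1.
Proof. by case: x => [[|[|//]]] H; [left | right]; apply/val_inj. Qed.

Lemma F2_two : 1 + 1 = 0 :> 'F_2.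
Proof. exact/val_inj. Qed.

Lemma polyF2_two : 1 + 1 = 0 :> {poly 'F_2}.
Proof. by rewrite -polyCD F2_two. Qed.

(* The images of the three rank one matrices [vq 0 l] are the three lines of
   F_2^2; the next two lemmas express this by annihilation. *)
Lemma vq_kills (m : qt (0 : 'F_2)) :
  m != 0 -> quat_norm m = 0 -> exists l, quat_conj (vq 0 l) * m = 0.
Proof.
case: m => a b c d.
case: (F2P a) => ->; case: (F2P b) => ->; case: (F2P c) => ->;
case: (F2P d) => -> // m0 /eqP N0 //;
first [ exists Lp; apply/eqP; vm_compute; reflexivity
      | exists Lm; apply/eqP; vm_compute; reflexivity
      | exists Lc; apply/eqP; vm_compute; reflexivity ].
Qed.

Lemma vq_pingpong (m : qt (0 : 'F_2)) l1 l2 :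
  m != 0 -> quat_conj (vq 0 l2) * m = 0 -> l1 <> inv3 l2 -> vq 0 l1 * m != 0.
Proof.
case: m => a b c d.
case: l1; case: l2 => //;
case: (F2P a) => ->; case: (F2P b) => ->; case: (F2P c) => ->;
by case: (F2P d) => -> //; move=> m0 /eqP.
Qed.

Lemma vq0_neq0 l : vq (0 : 'F_2) l != 0.
Proof. by case: l. Qed.

Lemma vq0_norm l : quat_norm (vq (0 : 'F_2) l) = 0.
Proof. by case: l; apply/eqP. Qed.

Lemma hq0_norm l : quat_norm (hq (0 : 'F_2) l) = 1.
Proof. by case: l; apply/eqP. Qed.

Lemma dq0_norm : quat_norm (dq (0 : 'F_2)) = 1.
Proof. exact/eqP. Qed.

Fixpoint reduced3 (s : seq letter3) : Prop :=
  if s is l :: s' then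
    (if s' is l' :: _ then l <> inv3 l' else True) /\ reduced3 s'
  else True.

Definition wq (F : comNzRingType) (c : F) (s : seq letter3) : qt c :=
  foldr (fun l x => vq c l * x) 1 s.

Lemma wq0_reduced s : reduced3 s -> wq (0 : 'F_2) s != 0.
Proof.
(* The induction also records that the conjugate of the first letter annihilates the product, that
   is, that both have the same image line; [vq_pingpong] needs this to prepend a further letter. *)
suff H : reduced3 s -> wq (0 : 'F_2) s != 0 /\
    (if s is l :: _ then quat_conj (vq 0 l) * wq (0 : 'F_2) s = 0 else True).
  by move/H => [].
elim: s => [|l s IHs] /=; first by split.
move=> [ls /IHs[s0 hs]]; split; last first.
  by rewrite mulrA quat_conj_mul vq0_norm scale0r mul0r.
case: s ls s0 hs {IHs} => [|l' s] ls s0 hs; last exact: vq_pingpong hs ls.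
by rewrite mulr1 vq0_neq0.
Qed.

Lemma wq0_norm l s : quat_norm (wq (0 : 'F_2) (l :: s)) = 0.
Proof. by rewrite /= (quat_normM F2_two) vq0_norm mul0r. Qed.

Local Notation Fz := {poly 'F_2}.
Local Notation A := (qt ('X : Fz)).

(** * The places z = 0 and z = infinity *)

Lemma z_neq0 : z != 0.
Proof. by rewrite tofrac_eq0 polyX_eq0. Qed.

Lemma zV : z * z^-1 = 1. Proof. exact/mulfV/z_neq0. Qed.

Definition embV (p : Fz) : K :=
  (map_poly (@tofrac {poly 'F_2} \o polyC) p).[z^-1].

Lemma embV_zmod : zmod_morphism embV.
Proof. by move=> p q; rewrite /embV rmorphB hornerD hornerN. Qed.

Lemma embV_monoid : monoid_morphism embV.
Proof.
split; first by rewrite /embV rmorph1 hornerC.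
by move=> p q; rewrite /embV rmorphM hornerM.
Qed.

HB.instance Definition _ := GRing.isZmodMorphism.Build Fz K embV embV_zmod.
HB.instance Definition _ := GRing.isMonoidMorphism.Build Fz K embV embV_monoid.

(* [false] stands for the place z = 0 and [true] for the place at infinity. *)
Definition emb (t : bool) : {rmorphism Fz -> K} :=
  if t then (embV : {rmorphism Fz -> K}) else (@tofrac Fz : {rmorphism Fz -> K}).

Definition unif (t : bool) : K := if t then z^-1 else z.

Lemma embVX : embV 'X = z^-1.
Proof. by rewrite /embV map_polyX hornerX. Qed.

Lemma embX t : emb t 'X = unif t.
Proof. by case: t; rewrite /= ?embVX. Qed.

Lemma unif_neq0 t : unif t != 0.
Proof. by case: t; rewrite ?invr_eq0 z_neq0. Qed.

(** The polynomial order embeds in [Q] once for each place. At infinity its indeterminate becomes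
    1/z, and [qinvert] carries the resulting quaternions over 1/z back to [Q]. *)
Definition alpha (t : bool) : A -> Q :=
  if t then fun y => qinvert z (qmap embV z^-1 y) else qmap (@tofrac Fz) z.

Lemma alphaM t x y : alpha t (x * y) = alpha t x * alpha t y.
Proof.
case: t => /=; last exact: qmapM.
by rewrite (qmapM embVX) (qinvertM K_two zV).
Qed.

Lemma alpha1 t : alpha t 1 = 1.
Proof.
case: t => /=; last exact: qmap1.
by rewrite qmap1 (qinvert1 K_two zV).
Qed.

Lemma alphaZ t k y : alpha t (k *: y) = emb t k *: alpha t y.
Proof.
case: t => /=; last exact: qmapZ.
by rewrite qmapZ (qinvertZ K_two zV).
Qed.

Lemma alpha_norm t y : quat_norm (alpha t y) = emb t (quat_norm y).
Proof.
case: t => /=; last exact: qmap_norm.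
by rewrite (qinvert_norm K_two zV) (qmap_norm embVX).
Qed.

Lemma alpha_conj t y : alpha t (quat_conj y) = quat_conj (alpha t y).
Proof.
case: t => /=; last exact: qmap_conj.
by rewrite qmap_conj (qinvert_conj K_two zV).
Qed.

(** With [alpha_vq], this says that the letters fixing the base vertex at one place move it at the
    other. Scalar factors do not affect classes. *)
Lemma alpha_hq l : alpha true (hq 'X l) = z^-1 *: alpha false (vq 'X (inv3 l)).
Proof.
rewrite /= (qmap_hq embVX) qmap_vq //; case: l => /=.
- rewrite (qinvert_conj K_two zV) (qinvert_bq1 K_two zV).
  by congr Quat => /=; rewrite ?mulrN ?mulrDr.
- by rewrite (qinvert_bq1 K_two zV).
- by rewrite (qinvert_cq1 K_two zV).
Qed.

Lemma alpha_vq l : alpha true (vq 'X l) = z^-1 *: alpha false (hq 'X l).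
Proof.
rewrite /= (qmap_vq embVX) qmap_hq //; case: l => /=.
- by rewrite (qinvert_bq2 K_two zV).
- rewrite (qinvert_conj K_two zV) (qinvert_bq2 K_two zV).
  by congr Quat => /=; rewrite ?mulrN ?mulrDr ?opprK ?addrK // mulrN opprK addrK.
- by rewrite (qinvert_cq2 K_two zV).
Qed.

Lemma alpha_dq : alpha true (dq 'X) = z^-1 *: alpha false (dq 'X).
Proof.
by rewrite /= (qmap_dq embVX) qmap_dq // (qinvert_dq K_two zV).
Qed.

(* [r] is a reversal of [p]. *)
Lemma embV_reverse (p : Fz) : exists n (r : Fz),
  [/\ embV p * z ^+ n = tofrac r, (size r <= n.+1)%N & r`_n = p.[0]].
Proof.
elim/poly_ind: p => [|p c [n [r [pr sr rn]]]].
  by exists 0%N, 0; rewrite rmorph0 mul0r rmorph0 size_poly0 coef0 horner0.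
exists n.+1, (r + c%:P * 'X^(n.+1)); split.
- rewrite rmorphD rmorphM /= embVX mulrDl rmorphD rmorphM rmorphXn /= -pr; congr (_ + _).
    by rewrite exprS mulrA mulfVK ?z_neq0.
  by rewrite /embV map_polyC hornerC.
- rewrite (leq_trans (size_polyD _ _)) // geq_max (leq_trans sr) //=.
  by rewrite (leq_trans (size_polyMleq _ _)) // size_polyXn addnS /=
    -(add1n n.+1) leq_add2r size_polyC_leq1.
- rewrite coefD nth_default ?add0r; last exact: leq_trans sr _.
  by rewrite coefMXn ltnn subnn coefC hornerD hornerMX hornerC mulr0 add0r.
Qed.

(** At infinity the constant term of [p] is the top coefficient of its reversal, and the reversal
    vanishes with [embV p]. *)
Lemma emb_eq0 t (p : Fz) : emb t p = 0 -> p.[0] = 0.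
Proof.
case: t => /= [p0|/eqP]; last by rewrite tofrac_eq0 => /eqP ->; rewrite horner0.
have [n [r [/esym]]] := embV_reverse p.
rewrite p0 mul0r => /eqP; rewrite tofrac_eq0 => /eqP -> _ <-.
by rewrite coef0.
Qed.

Definition red (y : A) : qt (0 : 'F_2) := qmap (@horner_eval _ (0 : 'F_2)) 0 y.

Lemma ev0X : @horner_eval _ (0 : 'F_2) 'X = 0.
Proof. by rewrite /horner_eval hornerX. Qed.

Lemma redM x y : red (x * y) = red x * red y. Proof. exact: qmapM ev0X x y. Qed.

Lemma red_norm y : quat_norm (red y) = (quat_norm y).[0].
Proof. exact: qmap_norm ev0X y. Qed.

Lemma red_wq s : red (wq 'X s) = wq 0 s.
Proof.
elim: s => [|l s IHs]; first exact: qmap1.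
by rewrite /= redM IHs [red _](qmap_vq ev0X).
Qed.

Lemma red_scalar t y k : alpha t y = k%:A -> red y = (q1 (red y))%:A.
Proof.
move=> yk; have []: [/\ (qI y).[0] = 0, (qJ y).[0] = 0 & (qIJ y).[0] = 0].
  case: t yk => /= yk; last first.
    by move: yk; rewrite /qmap => -[_]; rewrite ?mulr0 => h1 h2 h3; split;
      apply: (@emb_eq0 false).
  have := congr1 (qrevert z^-1) yk; rewrite (qinvertK K_two zV) => -[_].
  rewrite ?(mulr0, addr0) => h1 h2 h3.
  by split; apply: (@emb_eq0 true).
rewrite /red /qmap /= /horner_eval => -> -> ->.
by congr Quat; rewrite ?mulr0 ?mulr1.
Qed.

(* [x] and [y] fix the base vertex, which a nonempty reduced word moves. *)
Lemma word_not_scalar t s x y k : reduced3 s ->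
  (quat_norm x).[0] != 0 -> (quat_norm y).[0] != 0 ->
  alpha t (x * wq 'X s * y) = k%:A -> s = [::].
Proof.
case: s => // l s rs x0 y0 /red_scalar.
rewrite (redM (x * _)) (redM x) red_wq; set m := wq 0 (l :: s); set r := q1 _ => xmy.
have m0 : m != 0 := wq0_reduced rs.
have mN : quat_norm m = 0 := wq0_norm l s.
clearbody m.
have rN : r ^+ 2 = 0.
  rewrite -(quat_norm_scalar F2_two 0 (1 + 0 ^+ 3)) -xmy !(quat_normM F2_two).
  by rewrite mN mulr0 mul0r.
have r0 : r = 0 by apply/eqP; rewrite -sqrf_eq0 rN.
(* Multiplying by both conjugates leaves [m] times the norms of the reductions of [x] and [y]. These
   are nonzero in F_2, hence equal to 1, so [m] would vanish. *)
have := congr1 (fun q => quat_conj (red x) * q * quat_conj (red y)) xmy.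
rewrite /= r0 scale0r mulr0 mul0r -!mulrA quat_mul_conj !mulrA quat_conj_mul.
rewrite mulr_algl -scalerAl mulr_algr !red_norm.
have [/eqP|->] := F2P (quat_norm x).[0]; first by rewrite (negPf x0).
have [/eqP|->] := F2P (quat_norm y).[0]; first by rewrite (negPf y0).
by rewrite !scale1r => /eqP; rewrite (negPf m0).
Qed.

(** * Quaternions representing classes of units *)

Lemma scalar_in_frakO k : (k%:A : Q) \in in_frakO -> k \in inR.
Proof. by case/and4P; rewrite /= mulr1. Qed.

(** A priori [k] lies only in [K]; but [k] and its inverse are coordinates of [u] and of its
    inverse, so both lie in [R]. *)
Lemma scalar_unit (u : units frakO) k :
  val_frakO (uval u) = k%:A -> u \in is_scalar.
Proof.
move=> uk; have uu' : k *: val_frakO (uinv u) = 1.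
  by rewrite -mulr_algl -uk -[LHS]/(val_frakO (uval u * uinv u)) uvalK.
have k0 : k != 0.
  by apply/eqP => k0; move/eqP: uu'; rewrite k0 scale0r eq_sym oner_eq0.
have u'k : val_frakO (uinv u) = k^-1%:A.
  by rewrite -uu' scalerA mulVf // scale1r.
have kR : k \in inR by apply: scalar_in_frakO; rewrite -uk; apply: valP.
have kR' : k^-1 \in inR by apply: scalar_in_frakO; rewrite -u'k; apply: valP.
apply/asboolP.
have kk : MkR kR * MkR kR' = 1 by apply: val_inj; rewrite /= mulfV.
have kk' : MkR kR' * MkR kR = 1 by apply: val_inj; rewrite /= mulVf.
by exists (mkunit kk kk').
Qed.

Lemma scale_ratio (F : fieldType) (V : lmodType F) (k l : F) (x y : V) :
  k != 0 -> k *: x = y -> l *: x = (l / k) *: y.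
Proof. by move=> k0 <-; rewrite scalerA mulfVK. Qed.

(** Allowing a factor from [K] lets conjugates stand for inverses and lets representatives be scaled
    into the polynomial order at either place. *)
Definition represents (q : Q) (x : GR) : Prop := exists u k,
  [/\ k != 0, val_frakO (uval u) = k *: q & x = qclass scalar_units u].

Lemma represents_uniq q x y : represents q x -> represents q y -> x = y.
Proof.
move=> [u [k [k0 uq ->]]] [v [l [l0 vq ->]]]; apply/eqP; rewrite qclass_eq.
apply: (@scalar_unit _ (l / k)).
have u'u : k *: (val_frakO (uinv u) * q) = 1.
  by rewrite scalerAr -uq -[LHS]/(val_frakO (uinv u * uval u)) uinvK.
rewrite -[LHS]/(val_frakO (uinv u) * val_frakO (uval v)).
rewrite vq -scalerAr; exact: scale_ratio k0 u'u.
Qed.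

Lemma representsZ q x k : k != 0 -> represents (k *: q) x <-> represents q x.
Proof.
move=> k0; split=> -[u [l [l0 uq xu]]]; exists u.
  exists (l * k); split; [exact: (mulf_neq0 l0 k0) | rewrite uq | exact: xu].
  rewrite scalerA. reflexivity.
exists (l / k); split; [exact: mulf_neq0 l0 (invr_neq0 k0) | | exact: xu].
rewrite uq; apply: (scale_ratio _ k0); reflexivity.
Qed.

Lemma represents1 : represents 1 1%g.
Proof.
exists 1%g, 1; split; [exact: oner_neq0 | rewrite scale1r; reflexivity |].
reflexivity.
Qed.

Lemma representsM q r x y :
  represents q x -> represents r y -> represents (q * r) (x * y)%g.
Proof.
move=> [u [k [k0 uq ->]]] [v [l [l0 vr ->]]]; exists (u * v)%g, (k * l).
split; [exact: (mulf_neq0 k0 l0) | | by rewrite -qclassM].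
rewrite -[LHS]/(val_frakO (uval u) * val_frakO (uval v)) uq vr.
rewrite -scalerAl -scalerAr scalerA; reflexivity.
Qed.

Lemma represents_norm q x : represents q x -> quat_norm q != 0.
Proof.
move=> [u [k [k0 uq _]]]; apply/eqP => q0.
have : val_frakO (uval u) * val_frakO (uinv u) = 1.
  by rewrite -[LHS]/(val_frakO (uval u * uinv u)) uvalK.
move/(congr1 (@quat_norm _ _ _)); rewrite (quat_normM K_two) uq.
rewrite (quat_normZ K_two) q0 mulr0 mul0r => /esym/eqP.
by rewrite -(scale1r 1) (quat_norm_scalar K_two) expr1n oner_eq0.
Qed.

Lemma representsV q x : represents q x -> represents (quat_conj q) x^-1%g.
Proof.
move=> qx; have := represents_norm qx; case: qx => [u [k [k0 uq ->]]] N0.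
have kN : k * quat_norm q != 0 := mulf_neq0 k0 N0.
exists (u^-1)%g, (k * quat_norm q)^-1.
split; [exact: (invr_neq0 kN) | | exact: (qinvE scalar_units u)].
have u'u : val_frakO (uinv u) * (k *: q) = 1.
  by rewrite -uq -[LHS]/(val_frakO (uinv u * uval u)) uinvK.
have qq : (k *: q) * ((k * quat_norm q)^-1 *: quat_conj q) = 1.
  rewrite -scalerAl -scalerAr quat_mul_conj scalerA scalerA (mulrAC k) divff //.
  exact: scale1r.
rewrite -[LHS]/(val_frakO (uinv u)) -[LHS]mulr1 -[X in _ * X = _]qq.
by rewrite mulrA u'u mul1r.
Qed.

Lemma represents1_scalar q : represents q 1%g -> exists k, q = k%:A.
Proof.
move=> [u [k [k0 uq /esym/eqP]]].
rewrite -[1%g]/(qclass scalar_units 1%g) eq_sym qclass_eq /same_coset invg1 mul1g.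
move=> /asboolP[r]; rewrite uq => /(congr1 ( *:%R k^-1)).
by rewrite !scalerA mulVf // scale1r => ->; eexists.
Qed.

Lemma represents_gen :
  [/\ represents (bq1 z) (GR_gen gb1), represents (bq2 z) (GR_gen gb2),
      represents (cq1 z) (GR_gen gc1), represents (cq2 z) (GR_gen gc2)
    & represents (dq z) (GR_gen gd)].
Proof.
split; [exists B1u | exists B2u | exists C1u | exists C2u | exists Du];
  exists 1; rewrite oner_eq0 scale1r unit_of_normE.
- by rewrite B1E.
- by rewrite B2E.
- by rewrite C1E.
- by rewrite C2E.
- by rewrite DE.
Qed.

(** * Presentations *)

Section UniversalProperty.
Local Open Scope group_scope.
Variables (S : choiceType) (G : groupType) (g : S -> G).

Definition letter_val (a : letter S) : G := if a.2 then (g a.1)^-1 else g a.1.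

Definition word_val (w : seq (letter S)) : G :=
  foldr (fun a x => letter_val a * x) 1 w.

Lemma letter_valV a : letter_val (linv a) = (letter_val a)^-1.
Proof. by case: a => s []; rewrite /letter_val //= invgK. Qed.

Lemma word_val_push a w : word_val (push a w) = letter_val a * word_val w.
Proof.
case: w => //= b w; case: eqP => //= ->.
by rewrite letter_valV mulVKg.
Qed.

Lemma word_val_wmul u v : word_val (wmul u v) = word_val u * word_val v.
Proof.
elim: u => [|a u IHu] /=; first by rewrite mul1g.
by rewrite word_val_push IHu mulgA.
Qed.

Definition fg_lift (x : free_group S) : G := word_val x.

Lemma fg_liftM : {morph fg_lift : x y / x * y}.
Proof. by move=> x y; apply: word_val_wmul. Qed.

HB.instance Definition _ :=
  isMultiplicative.Build (free_group S) G fg_lift fg_liftM.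

HB.instance Definition _ :=
  Multiplicative_isUMagmaMorphism.Build (free_group S) G fg_lift erefl.

Lemma fg_liftV : {morph fg_lift : x / x^-1}. Proof. exact: gmulfV. Qed.

Lemma fg_lift_gen s : fg_lift (fgen s) = g s.
Proof. exact: mulg1. Qed.

End UniversalProperty.

Section Presentation.
Local Open Scope group_scope.
Variables (S : choiceType) (G : groupType) (g : S -> G).
Variable rels : seq (free_group S).

Lemma fg_lift_id (x : free_group S) : fg_lift (@fgen S) x = x.
Proof.
case: x => w; rewrite /fg_lift /=; elim: w => [|a w IHw] rw; apply: val_inj => //.
rewrite /= (IHw (path_sorted rw)).
case: a rw => s []; rewrite /letter_val /=; case: w {IHw} => //= b w /andP[ba _];
  by rewrite (negPf ba).
Qed.

Lemma qclass_word (x : free_group S) :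
  qclass (normal_closure (mem rels)) x = fg_lift (@pgen S rels) x.
Proof.
rewrite -[x in LHS]fg_lift_id /fg_lift; elim: (word_of x) => //= a w IHw.
rewrite qclassM IHw; congr (_ * _).
by case: a => s []; rewrite /letter_val //= -[LHS]qinvE.
Qed.

Lemma qclass_rel r :
  r \in rels -> qclass (normal_closure (mem rels)) r = 1.
Proof.
move=> rr; apply/eqP; rewrite -[1]/(qclass (normal_closure (mem rels)) 1).
rewrite eq_sym qclass_eq /same_coset invg1 mul1g.
by apply/asboolP => N; apply.
Qed.

Hypothesis g_rels : forall r, r \in rels -> fg_lift g r = 1.

Let ker : {pred free_group S} := fun x => fg_lift g x == 1.

Let ker_group : group_closed ker.
Proof.
split=> [|x y /eqP x1 /eqP y1]; first by apply/eqP.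
by apply/eqP; rewrite [LHS](gmulfF (fg_lift g)) /= x1 y1 divgg.
Qed.

Let ker_conj (x y : free_group S) : x \in ker -> x ^ y \in ker.
Proof.
by move=> /eqP x1; apply/eqP; rewrite [LHS](gmulfJ (fg_lift g)) /= x1 conj1g.
Qed.

Definition pres_lift (X : presented_group rels) : G := fg_lift g (repr X).

(** The kernel of [fg_lift g] is a normal subgroup containing the relators, hence their normal
    closure, so the value does not depend on the chosen word. *)
Lemma pres_liftE x :
  pres_lift (qclass (normal_closure (mem rels)) x) = fg_lift g x.
Proof.
have := same_coset_repr (normal_closure (mem rels)) x.
move=> /asboolP /(_ (NormalSubgroup ker_group ker_conj)) H.
have /eqP : (repr (qclass (normal_closure (mem rels)) x))^-1 * x \in ker.
  by apply: H => r /g_rels/eqP.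
by rewrite gmulfM gmulfV /= => /mulg1_eq <-; rewrite invgK.
Qed.

Lemma pres_liftM : {morph pres_lift : x y / x * y}.
Proof.
move=> X Y; have [x ->] := qclassP X; have [y ->] := qclassP Y.
by rewrite -qclassM !pres_liftE fg_liftM.
Qed.

Lemma pres_lift1 : pres_lift 1 = 1.
Proof. exact: pres_liftE. Qed.

Lemma pres_liftV : {morph pres_lift : x / x^-1}.
Proof.
move=> X; have [x ->] := qclassP X.
by rewrite -[_^-1 in LHS]/(qinv _) qinvE !pres_liftE fg_liftV.
Qed.

Lemma pres_lift_gen s : pres_lift (pgen rels s) = g s.
Proof. by rewrite pres_liftE fg_lift_gen. Qed.

Lemma has_presentation_of : (forall X, pres_lift X = 1 -> X = 1) ->
  (forall x, exists X, pres_lift X = x) -> has_presentation g rels.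
Proof.
move=> ker1 onto.
pose f : {multiplicative presented_group rels -> G} :=
  HB.pack pres_lift (isMultiplicative.Build _ _ pres_lift pres_liftM).
exists f; split; last exact: pres_lift_gen.
have onto' x : exists X, pres_lift X == x by have [X <-] := onto x; exists X.
have liftK x := eqP (xchooseP (onto' x)).
exists (fun x => xchoose (onto' x)) => // X; apply/divg1_eq/ker1.
by rewrite pres_liftM pres_liftV liftK mulgV.
Qed.

End Presentation.

(** * Normal forms *)

Section Letters.
Local Open Scope group_scope.
Variables (G : groupType) (g : gen -> G).

(** These match [vq] for [false] and [hq] for [true]; hence [Lp] is b2 in the first case and the
    inverse of b1 in the second. *)
Definition lg (t : bool) (l : letter3) : G :=
  if t then match l with Lp => (g gb1)^-1 | Lm => g gb1 | Lc => g gc1 end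
  else match l with Lp => g gb2 | Lm => (g gb2)^-1 | Lc => g gc2 end.

Definition wg t (s : seq letter3) : G := foldr (fun l x => lg t l * x) 1 s.

Lemma square_relation (a b c e : G) :
  a * b * c * e = 1 -> b * c = a^-1 * e^-1 /\ a * b = e^-1 * c^-1.
Proof.
move=> abce; split.
  by apply: (mulgI a); apply: (mulIg e); rewrite mulVKg mulVg !mulgA.
by apply: (mulIg c); apply: (mulIg e); rewrite abce mulgVK mulVg.
Qed.

Hypothesis g_rels : forall r, r \in GR_rels -> fg_lift g r = 1.

Let gE := (fg_liftM g, fg_liftV g, fg_lift_gen g).

Lemma rels_values : [/\ [/\ g gc1 * g gc1 = 1, g gc2 * g gc2 = 1 & g gd * g gd = 1],
  [/\ g gc1 * g gc2 = g gc2 * g gc1, g gc1 * g gd = g gd * g gc1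
    & g gc2 * g gd = g gd * g gc2],
  g gb1 * g gb2 * g gc1 * g gb2 = 1, g gb1 * g gc2 * g gb1 * (g gb2)^-1 = 1
  & g gd * g gb1 * g gd * g gb1 = 1 /\ g gd * g gb2 * g gd * g gb2 = 1].
Proof.
have H n (r := nth 1 GR_rels n) : (n < 10)%N -> fg_lift g r = 1.
  by move=> n10; apply/g_rels/mem_nth.
split; [split | split | | | split].
- by have := H 0%N isT; rewrite /= !gE.
- by have := H 1%N isT; rewrite /= !gE.
- by have := H 2%N isT; rewrite /= !gE.
- by have := H 3%N isT; rewrite /= !gE => /divg1_eq.
- by have := H 4%N isT; rewrite /= !gE => /divg1_eq.
- by have := H 5%N isT; rewrite /= !gE => /divg1_eq.
- by have := H 6%N isT; rewrite /= !gE.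
- by have := H 7%N isT; rewrite /= !gE.
- by have := H 8%N isT; rewrite /= !gE.
- by have := H 9%N isT; rewrite /= !gE.
Qed.

Lemma lg_inv t l : lg t (inv3 l) = (lg t l)^-1.
Proof.
have [[c1 c2 _] _ _ _ _] := rels_values.
by case: t; case: l; rewrite /= ?invgK //; apply/esym/mulg1_eq.
Qed.

(* The nine squares at a vertex of the product of the two trees. *)
Lemma lg_swap l m : exists l' m', lg false l * lg true m = lg true m' * lg false l'.
Proof.
have [[c1 c2 _] [cc _ _] /square_relation[bc bb] /square_relation[cb bc'] _] :=
  rels_values.
have c1V : (g gc1)^-1 = g gc1 by apply: mulg1_eq.
have c2V : (g gc2)^-1 = g gc2 by apply: mulg1_eq.
have inv4 (a b c e : G) : a * b = c * e -> b^-1 * a^-1 = e^-1 * c^-1.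
  by rewrite -!invgM => ->.
(* Each of the two relators mixing b1 and b2 yields two squares, and inversion yields two more. With
   c1 c2 = c2 c1 these are exactly the nine cases. *)
have := inv4 _ _ _ _ bc; have := inv4 _ _ _ _ bb.
have := inv4 _ _ _ _ cb; have := inv4 _ _ _ _ bc'.
move: bc bb cb bc'; rewrite ?invgK ?c1V ?c2V => e1 e2 e3 e4 e5 e6 e7 e8.
case: l; case: m; rewrite /lg.
all: by [exists Lm, Lp | exists Lm, Lm | exists Lm, Lc | exists Lp, Lp | exists Lp, Lm
  | exists Lp, Lc | exists Lc, Lp | exists Lc, Lm | exists Lc, Lc].
Qed.

(** By the last two relators, conjugation by d inverts b1 and b2; it fixes the involutions c1 and
    c2. So it inverts every letter. *)
Lemma lg_d t l : g gd * lg t l = lg t (inv3 l) * g gd.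
Proof.
have [[c1 c2 d2] [_ dc1 dc2] _ _ [db1 db2]] := rels_values.
have dV : (g gd)^-1 = g gd by apply: mulg1_eq.
have [b1d _] := square_relation db1; have [b2d _] := square_relation db2.
rewrite dV in b1d b2d.
have b1d' : g gd * (g gb1)^-1 = g gb1 * g gd by [].
have b2d' : g gd * (g gb2)^-1 = g gb2 * g gd by [].
have conjd (b : G) : g gd * b^-1 = b * g gd -> g gd * b = b^-1 * g gd.
  by move=> h; apply: (mulgI b); rewrite mulVKg mulgA -h -mulgA mulVg mulg1.
by case: t; case: l; rewrite /= // conjd.
Qed.

Lemma wg_swap l h : exists h' l',
  lg false l * wg true h = wg true h' * lg false l'.
Proof.
elim: h l => [|m h IHh] l /=; first by exists [::], l; rewrite mulg1 mul1g.
have [l1 [m' lm]] := lg_swap l m; have [h' [l' lh]] := IHh l1.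
by exists (m' :: h'), l'; rewrite mulgA lm -mulgA lh mulgA.
Qed.

Lemma wg_d t s : g gd * wg t s = wg t (map inv3 s) * g gd.
Proof.
elim: s => [|l s IHs] /=; first by rewrite mulg1 mul1g.
by rewrite mulgA lg_d -mulgA IHs mulgA.
Qed.

Lemma wg_reduce t s : exists s', reduced3 s' /\ wg t s' = wg t s.
Proof.
elim: s => [|l s [s' [rs' ws]]]; first by exists [::].
rewrite /= -ws {s ws}.
case: s' rs' => [|l' s'] rs'; first by exists [:: l].
have [ll'|ll'] := pselect (l = inv3 l'); last by exists (l :: l' :: s').
exists s'; split; first by case: rs'.
by rewrite /= ll' lg_inv mulKg.
Qed.

(** Letters are prepended one at a time: one of b1, c1 joins [h], one of b2, c2 is moved past [h] by
    the squares and joins [v], and d passes through both, inverting their letters. *)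
Lemma normal_form (w : seq (letter gen)) : exists h v n,
  [/\ reduced3 h, reduced3 v
    & word_val g w = wg true h * wg false v * g gd ^+ (n : bool)].
Proof.
(* Reducedness can wait until the end, since [h] and [v] are reduced separately without changing
   their values. *)
suff [h [v [n ->]]] : exists h v (n : bool),
    word_val g w = wg true h * wg false v * g gd ^+ n.
  have [h' [rh' <-]] := wg_reduce true h; have [v' [rv' <-]] := wg_reduce false v.
  by exists h', v', n.
have [[_ _ dd] _ _ _ _] := rels_values.
elim: w => [|a w [h [v [n IHw]]]]; first by exists [::], [::], false; rewrite !mulg1.
have dP : exists h v (n : bool),
    g gd * word_val g w = wg true h * wg false v * g gd ^+ n.
  exists (map inv3 h), (map inv3 v), (~~ n).
  rewrite IHw !mulgA wg_d -(mulgA _ (g gd)) wg_d -!mulgA; congr (_ * (_ * _)).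
  by case: n {IHw}; rewrite ?mulg1 // dd.
have tP l : exists h v (n : bool),
    lg true l * word_val g w = wg true h * wg false v * g gd ^+ n.
  by exists (l :: h), v, n; rewrite IHw !mulgA.
have fP l : exists h v (n : bool),
    lg false l * word_val g w = wg true h * wg false v * g gd ^+ n.
  have [h' [l' lh]] := wg_swap l h; exists h', (l' :: v), n.
  by rewrite IHw !mulgA lh.
have [[c1 c2 _] _ _ _ _] := rels_values.
have c1V := mulg1_eq c1; have c2V := mulg1_eq c2; have dV := mulg1_eq dd.
case: a => s e; rewrite /= /letter_val /=; case: s; case: e; rewrite ?c1V ?c2V ?dV //.
- exact: (tP Lp).
- exact: (tP Lm).
- exact: (fP Lm).
- exact: (fP Lp).
- exact: (tP Lc).
- exact: (tP Lc).
- exact: (fP Lc).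
- exact: (fP Lc).
Qed.

End Letters.

(** * Injectivity: quaternions representing normal forms *)

Definition hw (F : comNzRingType) (c : F) (s : seq letter3) : qt c :=
  foldr (fun l x => hq c l * x) 1 s.

Definition dw (F : comNzRingType) (c : F) (n : bool) : qt c :=
  if n then dq c else 1.

Lemma norm1 (F : comNzRingType) (c : F) : quat_norm (1 : qt c) = 1.
Proof. by rewrite /quat_norm /= !(expr0n, mulr0, mul0r, expr1n, addr0, subr0). Qed.

Lemma norm_hw0 s : (quat_norm (hw 'X s : A)).[0] = 1.
Proof.
elim: s => [|l s IHs]; first by rewrite norm1 hornerC.
rewrite (quat_normM polyF2_two) hornerM IHs mulr1 -red_norm.
by rewrite /red (qmap_hq ev0X) hq0_norm.
Qed.

Lemma norm_dq0 : (quat_norm (dq 'X : A)).[0] = 1.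
Proof. by rewrite -red_norm /red (qmap_dq ev0X) dq0_norm. Qed.

Lemma norm_dw0 n : (quat_norm (dw 'X n : A)).[0] = 1.
Proof. by case: n; [exact: norm_dq0 | rewrite norm1 hornerC]. Qed.

Local Notation lG := (lg GR_gen).

Lemma represents_hq0 l : represents (alpha false (hq 'X l)) (lG true l).
Proof.
have [b1 _ c1 _ _] := represents_gen; rewrite /= qmap_hq //.
by case: l; [exact: representsV b1 | exact: b1 | exact: c1].
Qed.

Lemma represents_vq0 l : represents (alpha false (vq 'X l)) (lG false l).
Proof.
have [_ b2 _ c2 _] := represents_gen; rewrite /= qmap_vq //.
by case: l; [exact: b2 | exact: representsV b2 | exact: c2].
Qed.

Lemma zV_neq0 : z^-1 != 0. Proof. exact: (invr_neq0 z_neq0). Qed.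

Lemma represents_lg t l : represents (alpha t (vq 'X l)) (lG t l).
Proof.
case: t; last exact: represents_vq0.
by rewrite alpha_vq; apply/(representsZ _ _ zV_neq0)/represents_hq0.
Qed.

Lemma represents_d t : represents (alpha t (dq 'X)) (GR_gen gd).
Proof.
have [_ _ _ _ d] := represents_gen.
have d0 : represents (alpha false (dq 'X)) (GR_gen gd) by rewrite /= qmap_dq.
by case: t => //; rewrite alpha_dq; apply/(representsZ _ _ zV_neq0).
Qed.

Lemma represents_wg t s : represents (alpha t (wq 'X s)) (wg GR_gen t s).
Proof.
elim: s => [|l s IHs]; first by rewrite alpha1; apply: represents1.
by rewrite alphaM; exact: (representsM (represents_lg t l) IHs).
Qed.

Lemma represents_hw s : represents (alpha false (hw 'X s)) (wg GR_gen true s).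
Proof.
elim: s => [|l s IHs]; first by rewrite alpha1; apply: represents1.
by rewrite alphaM; exact: (representsM (represents_hq0 l) IHs).
Qed.

Lemma represents_dw t (n : bool) :
  represents (alpha t (dw 'X n)) (GR_gen gd ^+ n)%g.
Proof.
by case: n; [exact: represents_d | rewrite alpha1; apply: represents1].
Qed.

(** At z = 0 the words [h] and d^n have norms that do not vanish, so [v] must be empty. At infinity
    [h] is itself a word in the letters [vq], so it is empty as well. Finally d is not scalar,
    having IJ-coordinate 1. *)
Lemma normal_form_inj h v (n : bool) : reduced3 h -> reduced3 v ->
  (wg GR_gen true h * wg GR_gen false v * GR_gen gd ^+ n = 1)%g ->
  [/\ h = [::], v = [::] & n = false].
Proof.
move=> rh rv hvn.
have v0 : v = [::].
  have := representsM (representsM (represents_hw h) (represents_wg false v))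
    (represents_dw false n).
  rewrite hvn -!alphaM => /represents1_scalar[k]; apply: word_not_scalar => //.
    by rewrite norm_hw0.
  by rewrite norm_dw0.
have h0 : h = [::].
  have := representsM (representsM represents1 (represents_wg true h))
    (represents_dw true n).
  have -> : (1 * wg GR_gen true h * (GR_gen gd ^+ n) = 1)%g.
    by rewrite mul1g -hvn v0 mulg1.
  rewrite -(alpha1 true) -!alphaM => /represents1_scalar[k].
  by apply: word_not_scalar; rewrite ?norm1 ?hornerC ?norm_dw0.
split=> //; case: n hvn => //; rewrite h0 v0 /= !mul1g => hvn.
have := represents_d false; rewrite [GR_gen gd]hvn => /represents1_scalar[k].
rewrite /= qmap_dq // => /(congr1 (@qIJ _ _ _))/eqP.
by rewrite /= mulr0 oner_eq0.
Qed.

(** * Norms and divisibility *)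

Definition pi1 : Fz := 1 + 'X.
Definition rho : Fz := 1 + 'X + 'X^2.

Lemma F2_opp (p : Fz) : - p = p. Proof. exact: char2_opp polyF2_two p. Qed.

Lemma dvdX (p : Fz) : ('X %| p) = (p.[0] == 0).
Proof. by rewrite -[X in X %| p]subr0 -[X in _ - X]polyC0 dvdp_XsubCl. Qed.

Lemma dvd_pi1 (p : Fz) : (pi1 %| p) = (p.[1] == 0).
Proof. by rewrite /pi1 addrC -[1]F2_opp -[1]polyC1 dvdp_XsubCl. Qed.

Lemma size_pi1 : size pi1 = 2%N.
Proof. by rewrite /pi1 addrC -[1]polyC1 size_XaddC. Qed.

Lemma size_rho : size rho = 3%N.
Proof.
by rewrite /rho addrC size_polyDl size_polyXn // -/pi1 size_pi1.
Qed.

Lemma irr_pi1 : irreducible_poly pi1.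
Proof. by rewrite /pi1 addrC -[1]F2_opp -[1]polyC1; apply: irredp_XsubC. Qed.

Lemma irr_rho : irreducible_poly rho.
Proof.
apply: cubic_irreducible; rewrite ?size_rho // => x.
by rewrite /root !hornerE; have [-> | ->] := F2P x.
Qed.

Lemma coprime_X_pi1 n : coprimep ('X^n) pi1.
Proof.
rewrite coprimep_expl // coprimep_sym irreducible_poly_coprime; last exact: irr_pi1.
by rewrite dvd_pi1 hornerX.
Qed.

(** Modulo 1 + z the form becomes x^2 + xy + y^2, which is anisotropic over F_2. *)
Lemma nf1_eq0 (x y : Fz) : pi1 %| nf 'X x y -> (pi1 %| x) && (pi1 %| y).
Proof.
rewrite !dvd_pi1 /nf !hornerE.
by have [-> | ->] := F2P x.[1]; have [-> | ->] := F2P y.[1].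
Qed.

Lemma rho_remainder (p : Fz) : exists u a b, p = u * rho + (a%:P + b%:P * 'X).
Proof.
exists (p %/ rho), (p %% rho)`_0, (p %% rho)`_1; rewrite {1}(divp_eq p rho).
congr (_ + _); apply/polyP => i; rewrite coefD coefC coefMX coefC.
have sr : (size (p %% rho)%R <= 2)%N.
  by rewrite -ltnS -size_rho ltn_modp -size_poly_eq0 size_rho.
case: i => [|[|i]] /=; rewrite ?addr0 ?add0r //.
by rewrite nth_default // (leq_trans sr).
Qed.

(** Modulo [rho], z is a generator w of F_4, and x^2 + xy + w y^2 is anisotropic because w has trace
    1 over F_2. The proof checks all residues of degree at most one. *)
Lemma nf_rho_eq0 (x y : Fz) : rho %| nf 'X x y -> (rho %| x) && (rho %| y).
Proof.
have [u [k [l ->]]] := rho_remainder x; have [v [m [n ->]]] := rho_remainder y.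
rewrite (nf_reduce polyF2_two) dvdp_addr ?dvdp_mull // -/rho.
rewrite -!polyC_exp -!polyCM -!polyCD.
set a := k ^+ 2 + _ + _ + _ + _; set b := l ^+ 2 + _ + _ + _ + _ => dv.
have : a%:P + b%:P * 'X = 0.
  apply: contraTeq dv => nz; apply/negP => /(dvdp_leq nz); rewrite size_rho.
  apply/negP; rewrite -leqNgt (leq_trans (size_polyD _ _)) // geq_max.
  rewrite (leq_trans (size_polyC_leq1 _)) //= (leq_trans (size_polyMleq _ _)) //.
  by rewrite size_polyX addnS addn1 /= ltnS size_polyC_leq1.
move=> ab; have a0 : a = 0.
  by have := congr1 (fun p : Fz => p`_0) ab; rewrite coefD coefC coefMX coef0 /= addr0.
have b0 : b = 0.
  have := congr1 (fun p : Fz => p`_1) ab.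
  by rewrite coefD coefC coefMX coef0 coefC /= add0r.
clear dv ab; move: a0 b0; rewrite /a /b {a b} => /eqP + /eqP.
have [-> | ->] := F2P k; have [-> | ->] := F2P l; have [-> | ->] := F2P m;
have [-> | ->] := F2P n => // _ _.
by rewrite mul0r !addr0 !dvdp_mull.
Qed.

Definition places : Fz := 'X * pi1 * rho.

(** As [places] is z(1 + z^3), this makes the norm a unit of R. *)
Definition unit_norm (y : A) : Prop := exists n, quat_norm y %| places ^+ n.

Lemma unit_norm_neq0 y : unit_norm y -> quat_norm y != 0.
Proof.
have pl0 : places != 0.
  rewrite /places !mulf_neq0 ?polyX_eq0 //.
    by rewrite -size_poly_eq0 size_pi1.
  by rewrite -size_poly_eq0 size_rho.
by move=> [n]; apply: contraTneq => ->; rewrite dvd0p expf_eq0 (negPf pl0) andbF.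
Qed.

Lemma irreducible_not_dvd_power (p q r : Fz) n : irreducible_poly p ->
  ~~ (p %| r) -> r %| (p * q) ^+ n -> r %| q ^+ n.
Proof.
move=> irr_p pr; rewrite exprMn Gauss_dvdpr // coprimep_expr // coprimep_sym.
by rewrite irreducible_poly_coprime.
Qed.

Lemma F2_size1 (p : Fz) : size p = 1%N -> p = 1.
Proof.
move/eqP/size_poly1P => [c c0 ->]; case: (F2P c) c0 => ->; last by rewrite polyC1.
by rewrite eqxx.
Qed.

Lemma dvd_pi1_power (p : Fz) n : ~~ (pi1 %| p) -> p %| pi1 ^+ n -> p = 1.
Proof.
move=> pp; rewrite -[pi1]mulr1 => /(irreducible_not_dvd_power irr_pi1 pp).
by rewrite expr1n dvdp1 => /eqP/F2_size1.
Qed.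

Lemma irr_X : irreducible_poly ('X : Fz).
Proof. by rewrite -[X in irreducible_poly X]subr0 -polyC0; apply: irredp_XsubC. Qed.

(** Of the three primes in [places] only [pi1] can occur, at most once, and 1 is the only nonzero
    constant of F_2. *)
Lemma norm_1_or_pi1 (p : Fz) n : p %| places ^+ n -> p.[0] != 0 ->
  ~~ (rho %| p) -> ~~ (pi1 ^+ 2 %| p) -> p = 1 \/ p = pi1.
Proof.
rewrite /places => pn p0 pr pp; have {}pn : p %| pi1 ^+ n.
  apply: (irreducible_not_dvd_power irr_X); first by rewrite dvdX.
  by apply: (irreducible_not_dvd_power irr_rho pr); rewrite mulrC.
have [/dvdpP[q pq]|pi1p] := boolP (pi1 %| p); last by left; apply: dvd_pi1_power pn.
right; rewrite pq (@dvd_pi1_power q n) ?mul1r //.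
  by apply: contra pp => qp; rewrite pq expr2 dvdp_mul.
by rewrite (dvdp_trans _ pn) // pq dvdp_mulr.
Qed.

Lemma frac_ratio (k : K) : exists p q : Fz, q != 0 /\ k * tofrac q = tofrac p.
Proof.
elim/quotW: k => r; exists (frac r).1, (frac r).2; split; first exact: denom_ratioP.
rewrite -[_ * _]/(FracField.mul _ _); rewrite !piE; apply/eqP; rewrite piE /=.
by rewrite FracField.equivfE /FracField.mulf !numden_Ratio ?mulr1 ?mulf_neq0
  ?oner_eq0 ?denom_ratioP // mulrC.
Qed.

(* Both [k = p / q] and [embV m] have degree at most 0 in z. *)
Lemma degree_bound (k : K) (p q m c : Fz) n : q != 0 ->
  k * tofrac q = tofrac p -> (size p <= size q)%N ->
  tofrac c = z ^+ n * (k * embV m) -> (size c <= n.+1)%N.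
Proof.
move=> q0 kq pq ck; have [j [r [mr sr _]]] := embV_reverse m.
have [->|c0] := eqVneq c 0; first by rewrite size_poly0.
have /eqP : tofrac (c * q * 'X^j) = tofrac ('X^n * p * r).
  rewrite !rmorphM !rmorphXn /= -/z -kq -mr ck.
  by rewrite !mulrA; congr (_ * _); rewrite -!mulrA; congr (_ * (_ * _)); rewrite mulrC.
rewrite tofrac_eq => /eqP eqs; have nz : c * q * 'X^j != 0.
  by rewrite !mulf_neq0 // -size_poly_eq0 size_polyXn.
have p0 : p * r != 0.
  by apply: contraNneq nz; rewrite eqs -mulrA => ->; rewrite mulr0.
have := congr1 (fun f : Fz => size f) eqs.
have -> : 'X^n * p * r = p * r * 'X^n by rewrite -mulrA mulrC.
move: p0; rewrite mulf_eq0 negb_or => /andP[p0 r0].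
rewrite !size_mulXn ?mulf_neq0 // !size_mul //.
rewrite -!size_poly_gt0 in c0 q0 p0 r0.
move: c0 q0 p0 r0 pq sr.
move: (size c) (size q) (size p) (size r) => sc sq sp sr0.
lia.
Qed.

Lemma red_eq0 (y : A) : red y = 0 -> exists y', y = 'X *: y'.
Proof.
case: y => a b c d [].
rewrite /horner_eval => /eqP; rewrite -dvdX => /dvdpP[a' ->].
move=> /eqP; rewrite -dvdX => /dvdpP[b' ->].
move=> /eqP; rewrite -dvdX => /dvdpP[c' ->].
move=> /eqP; rewrite -dvdX => /dvdpP[d' ->].
by exists (Quat a' b' c' d'); congr Quat; rewrite mulrC.
Qed.

Lemma descent_step (y : A) : (quat_norm y).[0] = 0 -> exists y',
  y = 'X *: y' \/ exists l, quat_conj (vq 'X l) * y = 'X *: y'.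
Proof.
rewrite -red_norm => N0; have [/red_eq0[y' ->]|y0] := eqVneq (red y) 0.
  by exists y'; left.
have [l ly] := vq_kills y0 N0.
have /red_eq0[y' y'P] : red (quat_conj (vq 'X l) * y) = 0.
  by rewrite redM {1}/red qmap_conj (qmap_vq ev0X).
by exists y'; right; exists l.
Qed.

(** * Generation *)

Lemma norm_vq l : quat_norm (vq 'X l : A) = 'X * pi1.
Proof.
case: l; rewrite /= ?(quat_norm_conj polyF2_two) ?(norm_bq2 polyF2_two) //.
by rewrite (norm_cq2 polyF2_two).
Qed.

Lemma pi1_dvd_places : pi1 %| places.
Proof. by rewrite /places mulrAC dvdp_mull. Qed.

Definition generated (x : GR) : Prop := exists w, x = word_val GR_gen w.

Lemma generated1 : generated 1%g. Proof. by exists [::]. Qed.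

Lemma generated_cancel a x : generated a -> generated (a^-1 * x)%g -> generated x.
Proof.
move=> [u ua] [v vx]; exists (wmul u v).
by rewrite word_val_wmul -ua -vx mulVKg.
Qed.

Lemma generated_letter a : generated (letter_val GR_gen a).
Proof. by exists [:: a]; rewrite /= mulg1. Qed.

Lemma generated_lg t l : generated (lG t l).
Proof.
case: t; case: l.
- exact: (generated_letter (gb1, true)).
- exact: (generated_letter (gb1, false)).
- exact: (generated_letter (gc1, false)).
- exact: (generated_letter (gb2, false)).
- exact: (generated_letter (gb2, true)).
- exact: (generated_letter (gc2, false)).
Qed.

Section Descent.
Variables (t : bool) (C : GR -> Prop).
Hypothesis C_lg : forall l x, C x -> C ((lG t l)^-1 * x)%g.
Hypothesis C_generated : forall x y, unit_norm y -> (quat_norm y).[0] != 0 ->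
  represents (alpha t y) x -> C x -> generated x.

(** If y = z y', the z-valuation of the norm drops by 2. If a letter is stripped, z pi1 N(y) = z^2
    N(y') and it drops by 1. [C] carries a condition that must survive stripping, such as fixing the
    base vertex at the other place. *)
Lemma descent_valuation x y n : unit_norm y -> ~~ ('X^n %| quat_norm y) ->
  represents (alpha t y) x -> C x -> generated x.
Proof.
elim: n x y => [|n IHn] x y yU yn yx Cx; first by rewrite expr0 dvd1p in yn.
have [y0|y0] := eqVneq (quat_norm y).[0] 0; last exact: (C_generated yU y0 yx Cx).
have X0 : ('X : Fz) != 0 by rewrite polyX_eq0.
have eX0 : emb t 'X != 0 by rewrite embX unif_neq0.
have [y' [y'P|[l y'P]]] := descent_step y0.
  move: yU yn yx; rewrite y'P => -[m yU] yn.
  rewrite alphaZ => /(representsZ _ _ eX0) yx.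
  rewrite (quat_normZ polyF2_two) in yU yn.
  apply: (IHn x y') => //; first by exists m; apply: dvdp_trans yU; rewrite dvdp_mull.
  by apply: contra yn => yn; rewrite expr2 -mulrA exprS dvdp_mul // dvdp_mull.
have yN : pi1 * quat_norm y = 'X * quat_norm y'.
  apply: (mulfI X0); rewrite !mulrA -expr2 -(quat_normZ polyF2_two) -y'P.
  by rewrite (quat_normM polyF2_two) (quat_norm_conj polyF2_two) norm_vq.
have gx : represents (alpha t y') ((lG t l)^-1 * x)%g.
  apply/(representsZ _ _ eX0); rewrite -alphaZ -y'P alphaM alpha_conj.
  exact: (representsM (representsV (represents_lg t l)) yx).
apply: (generated_cancel (generated_lg t l)).
apply: (IHn _ y' _ _ gx (C_lg l Cx)).
  have [m ym] := yU; exists m.+1.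
  apply: (@dvdp_trans _ (pi1 * quat_norm y)); first by rewrite yN dvdp_mull.
  by rewrite (exprS places) dvdp_mul // pi1_dvd_places.
apply: contra yn => yn.
have := dvdp_mul (dvdpp ('X : Fz)) yn; rewrite -exprS -yN.
by rewrite Gauss_dvdpr // coprime_X_pi1.
Qed.

Lemma descent x y : unit_norm y ->
  represents (alpha t y) x -> C x -> generated x.
Proof.
move=> yU; apply: (@descent_valuation _ _ (size (quat_norm y))) => //.
apply/negP => /(dvdp_leq (unit_norm_neq0 yU)).
by rewrite size_polyXn ltnn.
Qed.

End Descent.

Lemma represents_ratio q r x : represents q x -> represents r x ->
  exists k, k != 0 /\ q = k *: r.
Proof.
move=> qx rx; have := representsM qx (representsV rx).
rewrite mulgV => /represents1_scalar[k qr].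
have N0 := represents_norm rx; have Nq := represents_norm qx.
have qk : q = (k / quat_norm r) *: r.
  have : quat_norm r *: q = k *: r.
    by rewrite -mulr_algr -quat_conj_mul mulrA qr mulr_algl.
  move=> h; rewrite -[LHS]scale1r (scale_ratio 1 N0 h) scalerA div1r mulrC; reflexivity.
exists (k / quat_norm r); split; last exact: qk.
apply/eqP => k0; move/eqP: Nq; apply.
by rewrite qk k0 (quat_normZ K_two) expr0n mul0r.
Qed.

(** * The stabiliser of the two base vertices *)

Lemma size_mulX_le1 (p : Fz) : (size ('X * p)%R <= 1)%N -> p = 0.
Proof.
move=> sp; apply/eqP; apply: contraLR sp => p0.
by rewrite mulrC size_mulX // -ltnNge ltnS size_poly_gt0.
Qed.

(* [x] fixes the base vertices at both places.  Comparing norms of the two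
   representatives shows that the scalar relating them has degree 0, so the
   coordinates of [y] in the basis adapted to infinity are constants. *)
Lemma degree0_is1 x (y y' : A) : quat_norm y = 1 \/ quat_norm y = pi1 ->
  (quat_norm y').[0] != 0 ->
  represents (alpha false y) x -> represents (alpha true y') x -> y = 1.
Proof.
move=> yN y'N yx y'x; have [k [k0 yk]] := represents_ratio yx y'x.
have [p [q [q0 kq]]] := frac_ratio k.
have [n [r [rN sr rn]]] := embV_reverse (quat_norm y').
(* The top coefficient of the reversal is the constant term of N(y'), which is nonzero, so [r] has
   degree exactly [n]. *)
have {}sr : size r = n.+1.
  apply/eqP; rewrite eqn_leq sr ltnNge; apply: contra y'N => sr'.
  by rewrite -rn nth_default.
have eqN : q ^+ 2 * 'X^n * quat_norm y = p ^+ 2 * r.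
  apply/eqP; rewrite -tofrac_eq !rmorphM !rmorphXn /= -/z -kq -rN.
  have := congr1 (@quat_norm _ _ _) yk; rewrite (quat_normZ K_two).
  rewrite (alpha_norm false) (alpha_norm true) /= => ->.
  apply/eqP; move: (tofrac q) (z ^+ n) (embV _) => f w e.
  by rewrite expr2 mulrACA (mulrACA k f k f) (mulrC w e) (mulrC (f * f)).
have Ny0 : quat_norm y != 0.
  by case: yN => ->; rewrite ?oner_eq0 // -size_poly_eq0 size_pi1.
have p0 : p != 0.
  apply: contraNneq k0 => p0; move/eqP: kq; rewrite p0 rmorph0 mulf_eq0.
  by rewrite tofrac_eq0 (negPf q0) orbF.
have r0 : r != 0 by rewrite -size_poly_eq0 sr.
(* In degrees, [eqN] reads 2 deg q + n + deg N(y) = 2 deg p + n. So deg N(y) is even, which excludes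
   [pi1]. *)
have [yN1 spq] : quat_norm y = 1 /\ size p = size q.
  have := congr1 (fun f : Fz => size f) eqN.
  rewrite mulrAC size_mulXn ?mulf_neq0 ?expf_neq0 // !size_mul ?expf_neq0 //.
  rewrite sr; rewrite -!size_poly_gt0 in p0 q0.
  case: yN => yN; rewrite yN ?size_poly1 ?size_pi1; move: p0 q0;
    move: (size p) (size q) => sp sq *; last lia.
  by split=> //; lia.
have bound m c j : tofrac c = z ^+ j * (k * embV m) -> (size c <= j.+1)%N.
  by apply: (degree_bound q0 kq); rewrite spq.
have coord := congr1 (qrevert z^-1) yk.
rewrite /= -(qinvertZ K_two zV) (qinvertK K_two zV) in coord.
case: coord.
case: y yN1 {yN yx yk Ny0 eqN} => y0 y1 y2 y3 N1 /= e0 e1 e2 e3.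
have s1 : (size y1 <= 1)%N by apply: (@bound (qI y') _ 0%N); rewrite mul1r.
have y23 : y2 + y3 = 0.
  apply: size_mulX_le1; apply: (@bound (qIJ y') _ 0%N).
  by rewrite mul1r -e3 rmorphM rmorphD.
have y12 : y1 + 'X * y2 = 0.
  apply: size_mulX_le1; apply: (@bound (qJ y') _ 0%N).
  by rewrite mul1r -e2 rmorphM rmorphD rmorphM /= -/z mulrDr expr2 mulrA.
have {}y12 : y1 = 'X * y2 by rewrite -[RHS]F2_opp; apply/eqP; rewrite -addr_eq0 y12.
have y20 : y2 = 0 by apply: size_mulX_le1; rewrite -y12.
have y10 : y1 = 0 by rewrite y12 y20 mulr0.
have y30 : y3 = 0 by rewrite -y23 y20 add0r.
have s0 : (size y0 <= 1)%N.
  apply: (@bound (q1 y') _ 0%N).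
  by rewrite mul1r -e0 y10 y20 y30 rmorph0 addr0 !mulr0 !addr0.
move: N1; rewrite y10 y20 y30 (size1_polyC s0).
have [-> | ->] := F2P y0`_0; last by rewrite polyC1.
rewrite (_ : Quat _ _ _ _ = 0%:A); last by rewrite scale0r.
by rewrite (quat_norm_scalar polyF2_two) expr0n => /eqP; rewrite eq_sym oner_eq0.
Qed.

Lemma tofrac_neq0 (p : Fz) : p != 0 -> tofrac p != 0.
Proof. by rewrite tofrac_eq0. Qed.

Lemma pi1_neq0 : pi1 != 0.
Proof. by rewrite -size_poly_eq0 size_pi1. Qed.

Lemma rho_neq0 : rho != 0.
Proof. by rewrite -size_poly_eq0 size_rho. Qed.

(* [Q] is ramified at [rho], where [dq] is a uniformiser. *)
Lemma divide_rho (y : A) : rho %| quat_norm y ->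
  exists y1, quat_conj (dq 'X) * y = rho *: y1.
Proof.
rewrite (quat_norm_nf polyF2_two) dvdp_addl; last by rewrite -/rho dvdp_mulr ?dvdp_mull.
case: y => a b c d /nf_rho_eq0/andP[/= /dvdpP[u ->] /dvdpP[v ->]].
by rewrite !(mulrC _ rho) (dq_divides polyF2_two) -/rho; eexists.
Qed.

Lemma coprime_pi1_rho : coprimep pi1 rho.
Proof.
rewrite irreducible_poly_coprime; last exact: irr_pi1.
by rewrite dvd_pi1 /rho !hornerE.
Qed.

(** Anisotropy modulo [pi1] is used twice: first for a and b, whose norm form is then divisible by
    [pi1 ^+ 2]; after cancelling one [pi1] and the coprime factor [rho], for c and d. *)
Lemma divide_pi1 (y : A) : pi1 ^+ 2 %| quat_norm y -> exists y1, y = pi1 *: y1.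
Proof.
case: y => a b c d; rewrite (quat_norm_nf polyF2_two) /= -/pi1 -/rho => dv.
have : pi1 %| nf 'X a b.
  have : pi1 %| nf 'X a b + pi1 * rho * nf 'X c d.
    by apply: dvdp_trans dv; rewrite expr2 dvdp_mulr.
  by rewrite dvdp_addl // -mulrA dvdp_mulr.
move=> /nf1_eq0/andP[/dvdpP[a' aa] /dvdpP[b' bb]]; move: dv.
rewrite aa bb !(mulrC _ pi1) (nfZ polyF2_two) dvdp_addr; last by rewrite dvdp_mulr.
rewrite expr2 -mulrA dvdp_mul2l ?pi1_neq0 // Gauss_dvdpr ?coprime_pi1_rho //.
move=> /nf1_eq0/andP[/dvdpP[c' ->] /dvdpP[d' ->]].
by exists (Quat a' b' c' d'); rewrite !(mulrC _ pi1).
Qed.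

Lemma unit_norm_dvd (y y1 : A) : quat_norm y1 %| quat_norm y ->
  unit_norm y -> unit_norm y1.
Proof. by move=> dv [n yn]; exists n; apply: dvdp_trans yn. Qed.

(** Induction on the degree of N(y): a factor [rho] is removed by stripping d, a factor [pi1 ^+ 2]
    by dividing out a scalar. What remains has norm 1 or [pi1], and [degree0_is1] applies. *)
Lemma stabiliser_generated n x (y y' : A) : (size (quat_norm y) <= n)%N ->
  unit_norm y -> (quat_norm y).[0] != 0 -> (quat_norm y').[0] != 0 ->
  represents (alpha false y) x -> represents (alpha true y') x -> generated x.
Proof.
elim: n x y y' => [|n IHn] x y y' yn yU y0 y'0 yx y'x.
  by move: yn; rewrite leqn0 size_poly_eq0 (negPf (unit_norm_neq0 yU)).
have smaller (r : Fz) (y1 : A) : quat_norm y = r * quat_norm y1 -> (1 < size r)%N ->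
    [/\ (size (quat_norm y1) <= n)%N, unit_norm y1 & (quat_norm y1).[0] != 0].
  move=> yr r1; split.
  - have := unit_norm_neq0 yU; rewrite yr mulf_eq0 negb_or => /andP[r0 y10].
    move: yn r1; rewrite yr size_mul //; move: r0 y10; rewrite -!size_poly_gt0.
    by move: (size r) (size (quat_norm y1)) => *; lia.
  - by apply: (unit_norm_dvd _ yU); rewrite yr dvdp_mull.
  - by move: y0; rewrite yr hornerM mulf_eq0 negb_or => /andP[].
have [/divide_rho[y1 y1P]|rN] := boolP (rho %| quat_norm y).
  have yN : quat_norm y = rho * quat_norm y1.
    apply: (mulfI rho_neq0); rewrite mulrA -expr2 -(quat_normZ polyF2_two) -y1P.
    by rewrite (quat_normM polyF2_two) (quat_norm_conj polyF2_two) (norm_dq polyF2_two).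
  have [|s1 U1 N1] := smaller rho y1 yN; first by rewrite size_rho.
  apply: (@generated_cancel (GR_gen gd)).
    exact: (generated_letter (gd, false)).
  apply: (IHn _ y1 (quat_conj (dq 'X) * y') s1 U1 N1).
  - by rewrite (quat_normM polyF2_two) (quat_norm_conj polyF2_two) hornerM norm_dq0 mul1r.
  - apply/(representsZ _ _ (tofrac_neq0 rho_neq0)).
    rewrite -(alphaZ false) -y1P alphaM alpha_conj.
    exact: (representsM (representsV (represents_d false)) yx).
  - rewrite alphaM alpha_conj.
    exact: (representsM (representsV (represents_d true)) y'x).
have [/divide_pi1[y1 y1P]|pN] := boolP (pi1 ^+ 2 %| quat_norm y).
  have yN : quat_norm y = pi1 ^+ 2 * quat_norm y1.
    by rewrite y1P (quat_normZ polyF2_two).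
  have [|s1 U1 N1] := smaller (pi1 ^+ 2) y1 yN.
    by rewrite expr2 size_mul ?pi1_neq0 // size_pi1.
  apply: (IHn x y1 y' s1 U1 N1 y'0 _ y'x).
  move: yx; rewrite y1P (alphaZ false).
  by move/(representsZ _ _ (tofrac_neq0 pi1_neq0)).
have [m ym] := yU.
have y1 := degree0_is1 (norm_1_or_pi1 ym y0 rN pN) y'0 yx y'x.
have -> : x = 1%g; last exact: generated1.
by move: yx; rewrite y1 (alpha1 false) => /represents_uniq; apply; apply: represents1.
Qed.

(** * Clearing denominators and completing the descent *)

Lemma inR_ind (P : K -> Prop) : P 0 -> P 1 ->
  (forall k l, P k -> P l -> P (k + l)) -> (forall k l, P k -> P l -> P (k * l)) ->
  P z -> P (z * (1 + z ^+ 3))^-1 -> forall k, k \in inR -> P k.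
Proof.
move=> P0 P1 PD PM Pz Pi k /asboolP[p ->].
have Pp (q : Fz) : P (tofrac q).
  elim/poly_ind: q => [|q c IHq]; first by rewrite rmorph0.
  rewrite rmorphD rmorphM; apply: PD; first exact: PM.
  by have [-> | ->] := F2P c; rewrite ?rmorph0 ?rmorph1.
elim/poly_ind: p => [|p c IHp]; first by rewrite rmorph0 horner0.
rewrite rmorphD rmorphM /= map_polyX map_polyC hornerMXaddC.
by apply: PD; [exact: (PM _ _ IHp Pi) | exact: Pp].
Qed.

(** An element of the kernel has constant term 0, and its quotient by ['X] is again in the kernel,
    so the degree can be lowered indefinitely. *)
Lemma emb_inj t (p : Fz) : emb t p = 0 -> p = 0.
Proof.
have [n] := ubnP (size p); elim: n p => // n IHn p pn p0.
have := emb_eq0 p0 => /eqP; rewrite -dvdX => /dvdpP[q pq].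
have q0 : emb t q = 0.
  have /eqP : emb t q * unif t = 0 by rewrite -embX -rmorphM -pq.
  by rewrite mulf_eq0 (negPf (unif_neq0 t)) orbF => /eqP.
have [qz|qz] := eqVneq q 0; first by rewrite pq qz mul0r.
rewrite pq (IHn q) ?mul0r //.
by move: pn; rewrite pq size_mulX // ltnS.
Qed.

Definition clears (t : bool) (k : K) (n : nat) : Prop :=
  exists p, emb t p = emb t places ^+ n * k.

Lemma clears_add t k n m : clears t k n -> clears t k (n + m).
Proof.
move=> [p pk]; exists (p * places ^+ m).
by rewrite rmorphM rmorphXn pk exprD mulrAC.
Qed.

Lemma emb_places t : emb t places = unif t * (1 + unif t) * (1 + unif t + unif t ^+ 2).
Proof. by rewrite /places /pi1 /rho !(rmorphM, rmorphD, rmorph1, rmorphXn) embX. Qed.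

Lemma inR_cleared t k : k \in inR -> exists n, clears t k n.
Proof.
move: k; apply: inR_ind.
- by exists 0%N, 0; rewrite mulr0 rmorph0.
- by exists 0%N, 1; rewrite mulr1 rmorph1.
- move=> k l [n /(@clears_add _ _ _ _)nk] [m /(@clears_add _ _ _ _)ml].
  have [p pk] := nk m; have [q ql] := ml n.
  by exists (n + m)%N, (p + q); rewrite rmorphD pk ql (addnC m) mulrDr.
- move=> k l [n [p pk]] [m [q ql]].
  by exists (n + m)%N, (p * q); rewrite rmorphM pk ql exprD mulrACA.
- case: t; last by exists 0%N, 'X; rewrite expr0 mul1r.
  exists 1%N, (pi1 * rho).
  rewrite expr1 [places](_ : _ = 'X * (pi1 * rho)); last by rewrite mulrA.
  by rewrite [in RHS]rmorphM /= embVX mulrAC mulVf ?z_neq0 // mul1r.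
(* With w = 1/z, w(1 + w^3) = w^5 z(1 + z^3); this is the source of the fifth power. *)
- case: t; [exists 1%N, ('X^5) | exists 1%N, 1]; rewrite expr1 emb_places.
    rewrite /unif (places_inversion K_two zV) -mulrA divff ?z_unit // mulr1.
    by rewrite rmorphXn /= embVX.
  by rewrite /unif (places_factors K_two) divff ?z_unit // rmorph1.
Qed.

Lemma zV_in_inR : z^-1 \in inR.
Proof.
rewrite (_ : z^-1 = (1 + z ^+ 3) * (z * (1 + z ^+ 3))^-1) ?in_inR //.
have := z_unit; rewrite mulf_eq0 negb_or => /andP[_ nz].
by rewrite invfM mulrC mulfVK.
Qed.

Lemma integral_multiple t (q : Q) : q \in in_frakO ->
  exists n y, alpha t y = emb t places ^+ n *: q.
Proof.
suff H (r : qt (unif t)) : q1 r \in inR -> qI r \in inR -> qJ r \in inR ->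
    qIJ r \in inR -> exists n (y : A), qmap (emb t) (unif t) y = emb t places ^+ n *: r.
  case/and4P => a b c d; case: t H => H; last exact: (H q a b c d).
  have [||||n [y yr]] := H (qrevert z^-1 q);
    rewrite /= ?(zV_in_inR, in_inR, a, b, c, d) //.
  exists n, y; rewrite /= [qmap _ _ _]yr (qinvertZ K_two zV) (qrevertK K_two zV).
  by [].
case: r => a b c d /= /(inR_cleared t)[n1 na] /(inR_cleared t)[n2 nb].
move=> /(inR_cleared t)[n3 nc] /(inR_cleared t)[n4 nd].
have [p1 e1] := clears_add (n2 + n3 + n4) na.
have [p2 e2] := clears_add (n1 + n3 + n4) nb.
have [p3 e3] := clears_add (n1 + n2 + n4) nc.
have [p4 e4] := clears_add (n1 + n2 + n3) nd.
exists (n1 + (n2 + n3 + n4))%N, (Quat p1 p2 p3 p4); rewrite /qmap /= e1 e2 e3 e4.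
by congr Quat; congr (_ ^+ _ * _); lia.
Qed.

(** Clearing denominators in a unit and in its inverse gives y and y' whose product is a power of
    [places]; taking norms, N(y) divides a power of [places]. *)
Lemma represented t (x : GR) :
  exists y, unit_norm y /\ represents (alpha t y) x.
Proof.
have [u ->] := qclassP x.
have [n [y yu]] := integral_multiple t (valP (uval u)).
have [m [y' yu']] := integral_multiple t (valP (uinv u)).
have e0 j : emb t places ^+ j != 0.
  apply: expf_neq0; apply/eqP => /emb_inj/eqP.
  by rewrite !mulf_eq0 polyX_eq0 (negPf pi1_neq0) (negPf rho_neq0).
exists y; split.
  exists ((n + m) * 2)%N; apply/dvdpP; exists (quat_norm y').
  apply/eqP; rewrite -subr_eq0; apply/eqP/(@emb_inj t)/eqP.
  rewrite rmorphB subr_eq0 rmorphM rmorphXn -!alpha_norm mulrC; apply/eqP.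
  rewrite -(quat_normM K_two) yu yu' -scalerAl -scalerAr scalerA -exprD.
  rewrite [val _ * val _](_ : _ = 1); last first.
    by rewrite -[LHS]/(val_frakO (uval u * uinv u)) uvalK.
  by rewrite (quat_norm_scalar K_two) exprM.
exists u, (emb t places ^+ n)^-1; split; [exact: (invr_neq0 (e0 n)) | | reflexivity].
rewrite yu scalerA mulVf ?e0 // scale1r; reflexivity.
Qed.

(** The descent runs first at infinity, with no side condition, then at z = 0 keeping the base
    vertex at infinity fixed. The second descent preserves this condition because its letters become
    [hq] letters at infinity. *)
Lemma all_generated (x : GR) : generated x.
Proof.
have [y [yU yx]] := represented true x.
apply: (@descent true (fun=> True) _ _ x y yU yx) => // {yU yx} {}x {}y _ y0 yx _.
have [y' [y'U y'x]] := represented false x.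
pose C (x : GR) := exists y : A, (quat_norm y).[0] != 0 /\ represents (alpha true y) x.
apply: (@descent false C _ _ x y' y'U y'x); last by exists y.
  move=> l a [w [w0 wa]]; exists (quat_conj (hq 'X (inv3 l)) * w); split.
    rewrite (quat_normM polyF2_two) (quat_norm_conj polyF2_two) hornerM.
    by rewrite -(red_norm (hq _ _)) /red (qmap_hq ev0X) hq0_norm mul1r.
  rewrite alphaM alpha_conj alpha_hq inv3K.
  apply: representsM wa; apply: representsV; apply/(representsZ _ _ zV_neq0).
  exact: represents_vq0.
move=> a w wU w0 wa [w' [w'0 w'a]].
exact: (stabiliser_generated (leqnn _) wU w0 w'0 wa w'a).
Qed.

(** * The relations in G(R) and the isomorphism *)

Lemma represents_scalar k x : represents k%:A x -> x = 1%g.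
Proof.
move=> kx; have := represents_norm kx; rewrite (quat_norm_scalar K_two).
rewrite expf_eq0 /= => k0.
by move/(representsZ _ _ k0): kx => /represents_uniq; apply; apply: represents1.
Qed.

Lemma GR_rels_hold r : r \in GR_rels -> fg_lift GR_gen r = 1%g.
Proof.
have [b1 b2 c1 c2 d] := represents_gen.
have comm a b q s : represents q a -> represents s b -> q * s = s * q ->
    (a * b / (b * a))%g = 1%g.
  move=> qa sb qs; have := representsM qa sb; rewrite qs => ab.
  by rewrite (represents_uniq ab (representsM sb qa)) mulgV.
have E := (fg_liftM GR_gen, fg_liftV GR_gen, fg_lift_gen GR_gen).
rewrite !inE => /or4P[/eqP->|/eqP->|/eqP->|/or4P[/eqP->|/eqP->|/eqP->|]].
- have := representsM c1 c1.
  rewrite (rel_c1c1 K_two) !E; exact: represents_scalar.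
- have := representsM c2 c2.
  rewrite (rel_c2c2 K_two) !E; exact: represents_scalar.
- have := representsM d d.
  rewrite (rel_dd K_two) !E; exact: represents_scalar.
- rewrite !E; exact: (comm _ _ _ _ c1 c2 (rel_c1c2 K_two z)).
- rewrite !E; exact: (comm _ _ _ _ c1 d (rel_c1d K_two z)).
- rewrite !E; exact: (comm _ _ _ _ c2 d (rel_c2d K_two z)).
move=> /or4P[/eqP->|/eqP->|/eqP->|/eqP->].
- have := representsM (representsM (representsM b1 b2) c1) b2.
  rewrite (rel_bbcb K_two) !E; exact: represents_scalar.
- have := representsM (representsM b1 c2) b1; rewrite (rel_bcb K_two) => bcb.
  have z1 : 1 + z != 0.
    by have := represents_norm b1; rewrite (norm_bq1 K_two).
  rewrite !E (represents_uniq (proj1 (representsZ _ _ z1) bcb) b2).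
  exact: mulgV.
- have := representsM (representsM (representsM d b1) d) b1.
  rewrite (rel_db1 K_two) !E; exact: represents_scalar.
- have := representsM (representsM (representsM d b2) d) b2.
  rewrite (rel_db2 K_two) !E; exact: represents_scalar.
Qed.

Local Notation P := (presented_group GR_rels).
Local Notation lift := (@pres_lift _ _ GR_gen GR_rels).

Lemma pgen_rels_hold r : r \in GR_rels -> fg_lift (@pgen _ GR_rels) r = 1%g.
Proof. by move=> rr; rewrite -qclass_word; apply: qclass_rel. Qed.

Lemma lift_lg t l : lift (lg (@pgen _ GR_rels) t l) = lg GR_gen t l.
Proof.
by case: t; case: l;
  rewrite /= ?(pres_liftV GR_rels_hold) (pres_lift_gen GR_rels_hold).
Qed.

Lemma lift_wg t s : lift (wg (@pgen _ GR_rels) t s) = wg GR_gen t s.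
Proof.
elim: s => [|l s IHs]; first exact: (pres_lift1 GR_rels_hold).
by rewrite /= (pres_liftM GR_rels_hold) IHs lift_lg.
Qed.

(** The normal form is taken in the presented group, where only the relators are available; its
    image in G(R) is trivial only if it is empty. *)
Lemma lift_ker X : lift X = 1%g -> X = 1%g.
Proof.
have [w ->] := qclassP X; rewrite qclass_word /fg_lift.
have [h [v [n [rh rv ->]]]] := normal_form pgen_rels_hold w.
rewrite !(pres_liftM GR_rels_hold) !lift_wg => hvn.
have [|-> -> ->] := @normal_form_inj h v n rh rv; last by rewrite /= !mulg1.
by rewrite -hvn; case: n {hvn};
  rewrite ?(pres_lift1 GR_rels_hold) ?(pres_lift_gen GR_rels_hold).
Qed.

(* Generators gb1, gb2, gc1, gc2, gd stand for the classes b1, b2, c1, c2, d of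
   B1, B2, C1, C2, D in G(R). *)
Theorem theorem3p27 : has_presentation GR_gen GR_rels.
Proof.
apply: (has_presentation_of GR_rels_hold lift_ker) => x; have [w ->] := all_generated x.
exists (word_val (@pgen _ GR_rels) w).
elim: w => [|a w IHw]; first exact: (pres_lift1 GR_rels_hold).
rewrite /= (pres_liftM GR_rels_hold) IHw; congr (_ * _)%g.
by case: a => s [];
  rewrite /letter_val /= ?(pres_liftV GR_rels_hold) (pres_lift_gen GR_rels_hold).
Qed.
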